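(* Let $\alpha$ denote Otter's constant. If $s\in[0,1]$ satisfies $s\le\sqrt{\alpha}$, then for every $\lambda>0$, $$\limsup_{d\to\infty}\mathrm{KL}\big(\mathbb{P}^{(\lambda,s)}_d\,\big\Vert\,\mathbb{P}^{(\lambda,0)}_d\big)<\infty .$$ Consequently, for every $\lambda>0$ and $s\le\sqrt\alpha$, no one-sided test exists.
   Context: Rooted unlabeled trees: $\mathcal{X}_0=\{\bullet\}$ consists of the trivial tree. For $d\ge1$, an element $t\in\mathcal{X}_d$ is a family $t=\{N_\tau\}_{\tau\in\mathcal{X}_{d-1}}$ of non-negative integers with finite support ($N_\tau$ is the number of children of the root whose subtree is $\tau$); two such trees are equal iff all coordinates agree. Galton–Watson law: for $\mu>0$, $\mathrm{GW}^{(\mu)}_0$ is the Dirac mass at $\bullet$, and for $d\ge1$, $t=\{N_\tau\}\sim \mathrm{GW}^{(\mu)}_d$ means the $N_\tau$ are independent with $N_\tau\sim\mathrm{Poisson}(\mu\,\mathrm{GW}^{(\mu)}_{d-1}(\tau))$. Null model: $\mathbb{P}^{(\lambda,0)}_d=\mathrm{GW}^{(\lambda)}_d\otimes\mathrm{GW}^{(\lambda)}_d$ on $\mathcal{X}_d\times\mathcal{X}_d$. Correlated model $\mathbb{P}^{(\lambda,s)}_d$ ($\lambda>0$, $s\in[0,1]$): $\mathbb{P}^{(\lambda,s)}_0$ is the Dirac mass at $(\bullet,\bullet)$; for $d\ge1$, $(t,t')=(\{N_\tau\},\{N'_\tau\})\sim\mathbb{P}^{(\lambda,s)}_d$ is sampled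 as $N_\tau=\Delta_\tau+\sum_{\tau'\in\mathcal{X}_{d-1}}M_{\tau,\tau'}$, $N'_{\tau'}=\Delta'_{\tau'}+\sum_{\tau\in\mathcal{X}_{d-1}}M_{\tau,\tau'}$, where all $\Delta_\tau,\Delta'_\tau,M_{\tau,\tau'}$ are independent Poisson variables with parameters $\lambda(1-s)\mathrm{GW}^{(\lambda)}_{d-1}(\tau)$ for $\Delta_\tau,\Delta'_\tau$ and $\lambda s\,\mathbb{P}^{(\lambda,s)}_{d-1}(\tau,\tau')$ for $M_{\tau,\tau'}$. $\mathrm{KL}(P\Vert Q)=\mathbb{E}_P[\log\frac{dP}{dQ}]$. A one-sided test (for given $\lambda,s$) is a sequence of tests $\mathcal{T}_d:\mathcal{X}_d\times\mathcal{X}_d\to\{0,1\}$ with $\mathbb{P}^{(\lambda,0)}_d(\mathcal{T}_d=1)\to0$ as $d\to\infty$ and $\liminf_{d\to\infty}\mathbb{P}^{(\lambda,s)}_d(\mathcal{T}_d=1)>0$. Otter's constant $\alpha\approx0.3383219$ is the number such that the number $A_n$ of rooted unlabeled trees with $n$ nodes satisfies $A_n\sim D\,n^{-3/2}\alpha^{-n}$ for some $D>0$ (equivalently, $\alpha$ is the radius of convergence of $\sum_{n\ge1}A_nx^{n-1}$). *)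

(* Defs.v *)
From HB Require Import structures.
From mathcomp Require Import all_boot all_order all_algebra.
From mathcomp Require Import finmap.
From mathcomp Require Import all_classical all_reals.
From mathcomp Require Import ereal topology normedtype sequences esum exp.
Unset Printing Implicit Defensive.
Import Order.TTheory GRing.Theory Num.Theory.
Import numFieldNormedType.Exports.
Local Open Scope ring_scope.
Local Open Scope ereal_scope.
Local Open Scope classical_set_scope.

(* X 0 = {bullet}; X (d+1) = finitely supported families {N_tau}_{tau in X d}
   of nonnegative integers (N_tau = number of children of the root whose
   subtree is tau). *)
Fixpoint X (d : nat) : countType :=
  match d with
  | 0 => unit
  | d'.+1 => {fsfun X d' -> nat with 0%N}
  end.

Fixpoint tsize (d : nat) : X d -> nat :=
  match d return X d -> nat with
  | 0 => fun _ => 1%N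
  | d'.+1 => fun t => (1 + \sum_(tau <- finsupp t) t tau * tsize d' tau)%N
  end.

(* For a countable index type I and intensities nu : I -> R (nonnegative,
   summable), the law of an independent family (N_i)_{i in I} with
   N_i ~ Poisson(nu i), evaluated at a finitely supported realization n :
   prod_i e^{-nu i} nu_i^{n_i}/n_i!
     = exp(- sum_i nu i) * prod_{i in supp n} nu_i^{n_i}/n_i!. *)
Definition ppois {R : realType} {I : countType} (nu : I -> R)
  (n : {fsfun I -> nat with 0%N}) : R :=
  (expR (- fine (\esum_(i in [set: I]) (nu i)%:E)) *
   \prod_(i <- finsupp n) (nu i ^+ n i / (n i)`!%:R))%R.

Fixpoint GW {R : realType} (mu : R) (d : nat) : X d -> R :=
  match d return X d -> R with
  | 0 => fun _ => 1%R
  | d'.+1 => fun t => ppois (fun tau => mu * GW mu d' tau)%R t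
  end.

Definition null {R : realType} (lam : R) (d : nat) (x : X d * X d) : R :=
  (GW lam d x.1 * GW lam d x.2)%R.

(* Index set of the Poisson family (Delta, Delta', M) at depth d+1:
   inl (inl tau) ~ Delta_tau, inl (inr tau) ~ Delta'_tau,
   inr (tau, tau') ~ M_{tau,tau'}. *)
Definition cidx (d : nat) : countType := ((X d + X d) + (X d * X d))%type.

Definition rowsum d (w : {fsfun cidx d -> nat with 0%N}) (tau : X d) : nat :=
  (\sum_(i <- finsupp w)
     match i with inr p => if p.1 == tau then w i else 0 | _ => 0 end)%N.
Definition colsum d (w : {fsfun cidx d -> nat with 0%N}) (tau' : X d) : nat :=
  (\sum_(i <- finsupp w)
     match i with inr p => if p.2 == tau' then w i else 0 | _ => 0 end)%N.

Definition cmatch d (w : {fsfun cidx d -> nat with 0%N})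
  (t : X d.+1) (t' : X d.+1) : Prop :=
  (forall tau : X d, (t : {fsfun X d -> nat with 0%N}) tau
                     = (w (inl (inl tau)) + rowsum d w tau)%N) /\
  (forall tau' : X d, (t' : {fsfun X d -> nat with 0%N}) tau'
                     = (w (inl (inr tau')) + colsum d w tau')%N).

Fixpoint corr {R : realType} (lam s : R) (d : nat) : X d * X d -> R :=
  match d return X d * X d -> R with
  | 0 => fun _ => 1%R
  | d'.+1 => fun x =>
      let nu : cidx d' -> R := fun i =>
        match i with
        | inl (inl tau) => lam * (1 - s) * GW lam d' tau
        | inl (inr tau) => lam * (1 - s) * GW lam d' tau
        | inr p => lam * s * corr lam s d' p
        end%R in
      fine (\esum_(w in [set w | cmatch d' w x.1 x.2]) (ppois nu w)%:E)
  end.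

(* KL(P||Q) = E_P[log dP/dQ] (= +oo if P is not absolutely continuous
   w.r.t. Q); the expectation is the integral against the counting-weighted
   measure: positive part minus negative part. *)
Definition kl_term {R : realType} {T : countType} (p q : T -> R) (x : T) : \bar R :=
  if p x == 0%R then 0
  else if q x == 0%R then +oo
  else (p x * ln (p x / q x))%:E.

Definition KL {R : realType} {T : countType} (p q : T -> R) : \bar R :=
  \esum_(x in [set: T]) maxe (kl_term p q x) 0
  - \esum_(x in [set: T]) maxe (- kl_term p q x) 0.

Definition prob {R : realType} {T : countType} (p : T -> R) (A : set T) : R :=
  fine (\esum_(x in A) (p x)%:E).

Definition one_sided_test {R : realType} (lam s : R)
  (T : forall d : nat, X d * X d -> bool) : Prop :=
  ((fun d => prob (null lam d) [set x | T d x]) @ \oo --> (0%R : R)) /\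
  (0 < limn_einf (fun d => (prob (corr lam s d) [set x | T d x])%:E)).

(* A_n = number of rooted unlabeled trees with n nodes (such a tree has
   depth <= n-1, so it is represented exactly once in X (n-1)). *)
Definition Acount {R : realType} (n : nat) : \bar R :=
  \esum_(t in [set t : X n.-1 | tsize n.-1 t = n]) (1 : \bar R).

Definition otter_radius {R : realType} : \bar R :=
  ereal_sup [set x%:E | x in [set x : R | (0 <= x)%R /\
     \esum_(n in [set n : nat | (0 < n)%N]) (Acount n * (x ^+ n.-1)%:E) < +oo]].

Definition otter {R : realType} : R := fine (@otter_radius R).

(* Main.v *)
(** Write pi for the Galton-Watson law on [X d] and P for the correlated law.
    By induction on d there are functions f_b, indexed by the trees b in [X d],
    with sum_b f_b(t) f_b(t') = [t = t'] / pi(t) and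
    sum_b s^(|b|-1) f_b(t) f_b(t') = P(t,t') / (pi(t) pi(t')).
    A tree of depth d+1 is a Poisson configuration over [X d], so L^2 of its law
    is the Fock space over L^2(pi): the new functions are multivariate Charlier
    polynomials indexed by multisets of the old indices, i.e. by [X d.+1].  Both
    identities at depth d+1 follow because the two sides obey the same recursion
    when a child is added to t: on the Fock side by the commutation of creation
    and annihilation operators, on the Poisson side by the Mecke formula.

    Completeness makes the matrix (sqrt(pi(t)) f_b(t)) a coisometry, so two
    applications of Bessel's inequality bound the second moment of the likelihood
    ratio: sum P^2 / (pi x pi) <= B_d(s^2), where B_d(x) = sum_b x^(|b|-1).
    Below Otter's constant B_d is bounded in d; since unordered pairs of trees of
    depth d are trees of depth d+1, x^2 B_d(x)^2 <= 2 B_(d+1)(x), which upgrades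
    this to x^2 B_d(x) <= 2, a bound that passes to the limit at the critical x.
    Finally KL <= sum P^2 / (pi x pi), and P(A) <= K Q(A) + C / K for all K > 0
    when sum P^2 / Q <= C, so no one-sided test exists. *)

Require Import Defs.
From HB Require Import structures.
From mathcomp Require Import all_boot all_order all_algebra.
From mathcomp Require Import finmap.
From mathcomp Require Import all_classical all_reals.
From mathcomp Require Import ereal topology normedtype sequences esum exp.
From mathcomp Require Import ring lra zify.
Import Order.TTheory GRing.Theory Num.Theory.
Import numFieldNormedType.Exports.
Local Open Scope classical_set_scope.
Local Open Scope ring_scope.

Set Implicit Arguments.
Unset Strict Implicit.

Notation mset I := {fsfun I -> nat with 0%N}.
Notation tsize := Defs.tsize.

(** * Unordered sums of signed real families *)

Definition esumr {R : realType} {T : choiceType} (f : T -> R) : \bar R :=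
  \esum_(x in [set: T]) (f x)%:E.

Definition asummable {R : realType} {T : choiceType} (f : T -> R) : Prop :=
  (esumr (fun x => `|f x|)%R < +oo)%E.

(* Meaningful only for [asummable] families: [fine] sends infinite parts to 0. *)
Definition ssum {R : realType} {T : choiceType} (f : T -> R) : R :=
  (fine (esumr (fun x => Num.max (f x) 0)) -
   fine (esumr (fun x => Num.max (- f x) 0)))%R.

Section Ssum.
Local Open Scope ereal_scope.
Context {R : realType}.
Implicit Types T U : choiceType.

Lemma esumr_ge0 T (f : T -> R) : (forall x, (0 <= f x)%R) -> 0 <= esumr f.
Proof. by move=> f0; apply: esum_ge0 => x _; rewrite lee_fin. Qed.

Lemma le_esumr T (f g : T -> R) : (forall x, (f x <= g x)%R) -> esumr f <= esumr g.
Proof. by move=> fg; apply: le_esum => x _; rewrite lee_fin. Qed.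

Lemma esumrD T (f g : T -> R) : (forall x, (0 <= f x)%R) ->
  (forall x, (0 <= g x)%R) -> esumr (fun x => f x + g x)%R = esumr f + esumr g.
Proof.
move=> f0 g0; rewrite /esumr -esumD; first by apply: eq_esum.
- by move=> x _; rewrite lee_fin.
- by move=> x _; rewrite lee_fin.
Qed.

Lemma esumr_fin T (f : T -> R) : (forall x, (0 <= f x)%R) -> asummable f ->
  esumr f \is a fin_num.
Proof.
move=> f0; rewrite /asummable (_ : (fun x => _) = f); last first.
  by apply/funext => x; rewrite ger0_norm.
by move=> h; rewrite ge0_fin_numE// esumr_ge0.
Qed.

Lemma asummable_le T (f g : T -> R) : asummable g ->
  (forall x, (`|f x| <= g x)%R) -> asummable f.
Proof.
move=> sg fg; apply: le_lt_trans sg; apply: le_esumr => x.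
exact: le_trans (fg x) (ler_norm _).
Qed.

Lemma asummable_abs T (f : T -> R) : asummable f -> asummable (fun x => `|f x|)%R.
Proof.
rewrite /asummable => sf; apply: le_lt_trans sf; apply: le_esumr => x.
by rewrite normr_id.
Qed.

Lemma asummableD T (f g : T -> R) : asummable f -> asummable g ->
  asummable (fun x => f x + g x)%R.
Proof.
move=> sf sg; apply: le_lt_trans (lte_add_pinfty sf sg).
by rewrite -esumrD//; apply: le_esumr => x; rewrite ler_normD.
Qed.

Lemma asummableN T (f : T -> R) : asummable f -> asummable (fun x => - f x)%R.
Proof.
rewrite /asummable => sf; apply: le_lt_trans sf; apply: le_esumr => x.
by rewrite normrN.
Qed.

Lemma asummableB T (f g : T -> R) : asummable f -> asummable g ->
  asummable (fun x => f x - g x)%R.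
Proof. by move=> sf sg; apply: asummableD => //; apply: asummableN. Qed.

Lemma asummable0 T : asummable (fun _ : T => 0 : R)%R.
Proof.
rewrite /asummable /esumr esum1 ?ltry// => x _.
by rewrite normr0.
Qed.

Lemma asummable_pos T (f : T -> R) : asummable f ->
  asummable (fun x => Num.max (f x) 0)%R.
Proof.
rewrite /asummable => sf; apply: le_lt_trans sf; apply: le_esumr => x.
case: (leP (f x) 0%R) => h; by rewrite ?normr0.
Qed.

(** The positive part plus [h] equals the negative part plus [g] pointwise, so any summable
    nonnegative decomposition computes the sum. Linearity and Fubini then reduce to nonnegative
    families. *)
Lemma ssum_dec T (f g h : T -> R) :
  (forall x, (0 <= g x)%R) -> (forall x, (0 <= h x)%R) ->
  asummable g -> asummable h -> (forall x, f x = g x - h x)%R ->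
  ssum f = (fine (esumr g) - fine (esumr h))%R.
Proof.
move=> g0 h0 sg sh fE.
have sf : asummable f.
  by rewrite (_ : f = fun x => g x - h x)%R; [exact: asummableB|exact/funext].
have sp := asummable_pos sf.
have sn := asummable_pos (asummableN sf).
have e1 : (forall x, 0 <= Num.max (f x) 0)%R by move=> x; rewrite le_max lexx orbT.
have e2 : (forall x, 0 <= Num.max (- f x) 0)%R by move=> x; rewrite le_max lexx orbT.
suff : (fine (esumr (fun x => Num.max (f x) 0)) + fine (esumr h) =
        fine (esumr (fun x => Num.max (- f x) 0)) + fine (esumr g))%R.
  by rewrite /ssum; lra.
rewrite -!fineD ?esumr_fin// -!esumrD//; congr fine; apply: eq_esum => x _.
congr (_%:E); have := fE x.
by case: (leP (f x) 0%R); case: (leP (- f x)%R 0%R); lra.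
Qed.

Lemma ge0_ssum T (f : T -> R) : (forall x, (0 <= f x)%R) -> asummable f ->
  (ssum f)%:E = esumr f.
Proof.
move=> f0 sf; rewrite (@ssum_dec _ _ f (fun _ => 0)%R)//.
- rewrite [X in (_ - fine X)%R](_ : _ = 0); first by rewrite subr0 fineK// esumr_fin.
  by rewrite /esumr esum1.
- exact: asummable0.
- by move=> x; rewrite subr0.
Qed.

Lemma ssum_ge0 T (f : T -> R) : (forall x, (0 <= f x)%R) -> asummable f -> (0 <= ssum f)%R.
Proof. by move=> f0 sf; rewrite -lee_fin ge0_ssum// esumr_ge0. Qed.

Lemma eq_ssum T (f g : T -> R) : (forall x, f x = g x) -> ssum f = ssum g.
Proof. by move=> /funext ->. Qed.

Lemma ssum0 T : ssum (fun _ : T => 0 : R)%R = 0%R.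
Proof.
by rewrite (@ssum_dec _ _ (fun=> 0)%R (fun=> 0)%R) ?subrr//; apply: asummable0.
Qed.

Lemma ssumD T (f g : T -> R) : asummable f -> asummable g ->
  ssum (fun x => f x + g x)%R = (ssum f + ssum g)%R.
Proof.
move=> sf sg.
have e1 (k : T -> R) x : (0 <= Num.max (k x) 0)%R by rewrite le_max lexx orbT.
rewrite (@ssum_dec _ _ (fun x => Num.max (f x) 0 + Num.max (g x) 0)%R
   (fun x => Num.max (- f x) 0 + Num.max (- g x) 0)%R) /=.
- rewrite !esumrD//; try (by move=> x; rewrite le_max lexx orbT).
  rewrite !fineD ?esumr_fin//; try (by move=> x; rewrite le_max lexx orbT);
    try (apply: asummable_pos => //; exact: asummableN).
  by rewrite /ssum; lra.
- by move=> x; rewrite addr_ge0.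
- by move=> x; rewrite addr_ge0 // le_max lexx orbT.
- by apply: asummableD; apply: asummable_pos.
- by apply: asummableD; apply: asummable_pos; apply: asummableN.
- move=> x; case: (leP (f x) 0%R); case: (leP (- f x)%R 0%R);
  case: (leP (g x) 0%R); case: (leP (- g x)%R 0%R); lra.
Qed.

Lemma ssumN T (f : T -> R) : ssum (fun x => - f x)%R = (- ssum f)%R.
Proof.
rewrite /ssum opprB; congr (_ - fine (esumr _))%R.
by apply/funext => x; rewrite opprK.
Qed.

Lemma ssumB T (f g : T -> R) : asummable f -> asummable g ->
  ssum (fun x => f x - g x)%R = (ssum f - ssum g)%R.
Proof. by move=> sf sg; rewrite -ssumN -ssumD//; apply: asummableN. Qed.

Lemma le_ssum T (f g : T -> R) : asummable f -> asummable g ->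
  (forall x, (f x <= g x)%R) -> (ssum f <= ssum g)%R.
Proof.
move=> sf sg fg; rewrite -subr_ge0 -ssumB//; apply: ssum_ge0.
  by move=> x; rewrite subr_ge0.
exact: asummableB.
Qed.

Lemma asummable_sum T (J : eqType) (r : seq J) (F : J -> T -> R) :
  (forall j, j \in r -> asummable (F j)) ->
  asummable (fun x => \sum_(j <- r) F j x)%R.
Proof.
elim: r => [|j r IH] h.
  by rewrite (_ : (fun x => _) = fun=> 0%R); [exact: asummable0|
    apply/funext => x; rewrite big_nil].
rewrite (_ : (fun x => _) = (fun x => F j x + \sum_(j <- r) F j x)%R); last first.
  by apply/funext => x; rewrite big_cons.
apply: asummableD; first by apply: h; rewrite mem_head.
by apply: IH => i ir; apply: h; rewrite inE ir orbT.
Qed.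

Lemma ssum_sum T (J : eqType) (r : seq J) (F : J -> T -> R) :
  (forall j, j \in r -> asummable (F j)) ->
  ssum (fun x => \sum_(j <- r) F j x)%R = (\sum_(j <- r) ssum (F j))%R.
Proof.
elim: r => [|j r IH] h.
  by rewrite big_nil -[RHS](ssum0 T); apply: eq_ssum => x; rewrite big_nil.
rewrite big_cons -IH; last by move=> i ir; apply: h; rewrite inE ir orbT.
rewrite -ssumD; first by apply: eq_ssum => x; rewrite big_cons.
  by apply: h; rewrite mem_head.
by apply: asummable_sum => i ir; apply: h; rewrite inE ir orbT.
Qed.

(** Surjectivity is replaced by vanishing off the range. In the Mecke-type arguments [e] adds a
    particle to a multiset, and the missed points carry multiplicity zero. *)
Lemma esumr_reindex T U (e : T -> U) (f : U -> R) : injective e ->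
  (forall y, (0 <= f y)%R) ->
  (forall y, (forall x, e x <> y) -> f y = 0%R) ->
  esumr f = esumr (fun x => f (e x)).
Proof.
move=> ie f0 fz; rewrite /esumr (esumID (range e)) => [|y _]; last by rewrite lee_fin.
rewrite !setTI [X in _ + X]esum1 ?adde0; last first.
  by move=> y yN; rewrite fz// => x xy; apply: yN; exists x.
by rewrite esum_image// => x y _ _; exact: ie.
Qed.

Lemma asummable_reindex T U (e : T -> U) (f : U -> R) : injective e ->
  (forall y, (forall x, e x <> y) -> f y = 0%R) ->
  asummable (fun x => f (e x)) <-> asummable f.
Proof.
move=> ie fz; rewrite /asummable (esumr_reindex ie)// => y h.
by rewrite fz// normr0.
Qed.

Lemma ssum_reindex T U (e : T -> U) (f : U -> R) : injective e ->
  (forall y, (forall x, e x <> y) -> f y = 0%R) ->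
  ssum f = ssum (fun x => f (e x)).
Proof.
move=> ie fz; rewrite /ssum; congr (fine _ - fine _)%R; rewrite (esumr_reindex ie)//.
- by move=> y; rewrite le_max lexx orbT.
- by move=> y h; rewrite fz// maxxx.
- by move=> y; rewrite le_max lexx orbT.
- by move=> y h; rewrite fz// oppr0 maxxx.
Qed.

Lemma ssum1 T (a : T) (f : T -> R) : (forall x, x != a -> f x = 0%R) ->
  asummable f /\ ssum f = f a.
Proof.
move=> fz.
have E1 (k : R -> R) : k 0%R = 0%R -> (forall x, 0 <= k x)%R ->
    esumr (fun x => k (f x)) = (k (f a))%:E.
  move=> k0 kp; rewrite /esumr (esumID [set a]) => [|y _]; last by rewrite lee_fin.
  rewrite !setTI [X in _ + X]esum1 ?adde0 => [|y /eqP ya]; last by rewrite fz// k0.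
  by rewrite esum_set1// lee_fin.
split; first by rewrite /asummable (E1 (fun x => `|x|)%R) ?normr0 ?ltry.
rewrite /ssum (E1 (fun x => Num.max x 0)%R) ?maxxx//; last first.
  by move=> y; rewrite le_max lexx orbT.
rewrite (E1 (fun x => Num.max (- x) 0)%R) ?oppr0 ?maxxx//; last first.
  by move=> y; rewrite le_max lexx orbT.
by rewrite /=; case: (leP (f a) 0%R); case: (leP (- f a)%R 0%R); lra.
Qed.

Lemma esumr_pair T U (F : T * U -> R) : (forall p, (0 <= F p)%R) ->
  esumr F = \esum_(t in [set: T]) esumr (fun u => F (t, u)).
Proof.
move=> F0; rewrite /esumr (@esum_esum _ _ _ setT (fun=> setT) (fun t u => (F (t, u))%:E)).
  rewrite (_ : _ `*`` _ = setT); last by apply/seteqP; split.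
  by apply: eq_esum => -[].
by move=> *; rewrite lee_fin.
Qed.

Lemma asummable_slice T U (F : T * U -> R) t : asummable F ->
  asummable (fun u => F (t, u)).
Proof.
move=> sF; apply: le_lt_trans sF; rewrite esumr_pair//.
rewrite [leRHS](esumID [set t]); last by move=> *; exact: esumr_ge0.
rewrite !setTI esum_set1 ?leeDl//; last exact: esumr_ge0.
by apply: esum_ge0 => *; exact: esumr_ge0.
Qed.

Lemma ge0_pair T U (F : T * U -> R) : (forall p, (0 <= F p)%R) -> asummable F ->
  esumr F = esumr (fun t => fine (esumr (fun u => F (t, u)))).
Proof.
move=> F0 sF; rewrite esumr_pair//; apply: eq_esum => t _.
by rewrite fineK// esumr_fin//; exact: asummable_slice.
Qed.

Lemma ge0_pair_summable T U (F : T * U -> R) : (forall p, (0 <= F p)%R) ->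
  asummable F -> asummable (fun t => fine (esumr (fun u => F (t, u)))).
Proof.
move=> F0 sF; rewrite /asummable.
rewrite [X in esumr X](_ : _ = (fun t => fine (esumr (fun u => F (t, u))))).
  by rewrite -ge0_pair//; move: (esumr_fin F0 sF); rewrite ge0_fin_numE// esumr_ge0.
by apply/funext => t; rewrite ger0_norm// fine_ge0// esumr_ge0.
Qed.

Lemma ssum_pair T U (F : T * U -> R) : asummable F ->
  asummable (fun t => ssum (fun u => F (t, u))) /\
  ssum F = ssum (fun t => ssum (fun u => F (t, u))).
Proof.
move=> sF.
pose P p := Num.max (F p) 0%R; pose N p := Num.max (- F p)%R 0%R.
have P0 p : (0 <= P p)%R by rewrite /P le_max lexx orbT.
have N0 p : (0 <= N p)%R by rewrite /N le_max lexx orbT.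
have sP : asummable P by exact: asummable_pos.
have sN : asummable N by apply: asummable_pos; exact: asummableN.
have sP' := ge0_pair_summable P0 sP; have sN' := ge0_pair_summable N0 sN.
split; first exact: asummableB sP' sN'.
rewrite {1}/ssum -/P -/N (ge0_pair P0 sP) (ge0_pair N0 sN).
by symmetry; apply: ssum_dec => // t; rewrite fine_ge0// esumr_ge0.
Qed.

Lemma asummable_pair T U (F : T * U -> R) :
  (forall t, asummable (fun u => F (t, u))) ->
  asummable (fun t => ssum (fun u => `|F (t, u)|)%R) -> asummable F.
Proof.
move=> s1 s2; rewrite /asummable esumr_pair//; apply: le_lt_trans s2.
apply: le_esum => t _; rewrite -ge0_ssum//; last exact: asummable_abs.
by rewrite lee_fin ler_norm.
Qed.

Lemma esumrZ T (f : T -> R) c : (0 <= c)%R -> (forall x, (0 <= f x)%R) ->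
  asummable f -> esumr (fun x => c * f x)%R = (c * ssum f)%:E.
Proof.
move=> c0 f0 sf; apply/eqP; rewrite eq_le; apply/andP; split.
  apply: ge_ereal_sup => _ [X [finX XI]] <-.
  rewrite fsbig_finite//= sumEFin lee_fin -mulr_sumr ler_wpM2l//.
  rewrite -lee_fin ge0_ssum// -sumEFin; apply: esum_ge; exists X => //.
  by rewrite fsbig_finite.
have [->|cn0] := eqVneq c 0%R.
  by rewrite mul0r esumr_ge0// => x; rewrite mul0r.
have cp : (0 < c)%R by rewrite lt_neqAle eq_sym cn0.
rewrite EFinM ge0_ssum// -lee_pdivlMl//.
apply: ge_ereal_sup => _ [X [finX XI]] <-.
rewrite lee_pdivlMl//; apply: esum_ge; exists X => //.
rewrite !fsbig_finite//= !sumEFin -EFinM mulr_sumr lee_fin.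
by [].
Qed.

Lemma asummableZ T (f : T -> R) c : asummable f -> asummable (fun x => c * f x)%R.
Proof.
move=> sf; rewrite /asummable.
rewrite [X in esumr X](_ : _ = fun x => `|c| * `|f x|)%R; last first.
  by apply/funext => x; rewrite normrM.
by rewrite esumrZ ?ltry//; exact: asummable_abs.
Qed.

Lemma ssumZ T (f : T -> R) c : asummable f -> ssum (fun x => c * f x)%R = (c * ssum f)%R.
Proof.
move=> sf.
wlog c0 : c / (0 <= c)%R => [H|].
  have [/H//|c0] := leP 0%R c.
  have := H (- c)%R; rewrite oppr_ge0 (ltW c0) => /(_ isT).
  rewrite mulNr => /eqP; rewrite eq_sym eqr_oppLR => /eqP ->.
  by rewrite -ssumN; apply: eq_ssum => x; rewrite mulNr opprK.
have sp := asummable_pos sf.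
have sn := asummable_pos (asummableN sf).
have p0 (k : T -> R) x : (0 <= Num.max (k x) 0)%R by rewrite le_max lexx orbT.
rewrite (@ssum_dec _ _ (fun x => c * Num.max (f x) 0)%R (fun x => c * Num.max (- f x) 0)%R).
- rewrite !esumrZ//=; last by move=> x; rewrite le_max lexx orbT.
  rewrite -mulrBr; congr (_ * _)%R; rewrite [RHS]/ssum -!ge0_ssum//.
  by move=> x; rewrite le_max lexx orbT.
- by move=> x; rewrite mulr_ge0.
- by move=> x; rewrite mulr_ge0// le_max lexx orbT.
- exact: asummableZ.
- exact: asummableZ.
- move=> x; rewrite -mulrBr; congr (_ * _)%R.
  by case: (leP (f x) 0%R); case: (leP (- f x)%R 0%R); lra.
Qed.

Lemma ssum_prod T U (f : T -> R) (g : U -> R) : asummable f -> asummable g ->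
  asummable (fun p : T * U => f p.1 * g p.2)%R /\
  ssum (fun p : T * U => f p.1 * g p.2)%R = (ssum f * ssum g)%R.
Proof.
move=> sf sg; have sfg : asummable (fun p : T * U => f p.1 * g p.2)%R.
  apply: asummable_pair => /= [t|]; first exact: asummableZ.
  rewrite [X in asummable X](_ : _ = fun t => ssum (fun u => `|g u|)%R * `|f t|)%R.
    by apply: asummableZ; exact: asummable_abs.
  apply/funext => t; rewrite mulrC -ssumZ; last exact: asummable_abs.
  by apply: eq_ssum => u; rewrite normrM.
split => //; have [_ ->] := ssum_pair sfg => /=.
rewrite [RHS]mulrC -ssumZ//; apply: eq_ssum => t; rewrite ssumZ//.
exact: mulrC.
Qed.

Lemma asummable_fin T (f : T -> R) (M : R) :
  (forall F : {fset T}, \sum_(x <- F) `|f x| <= M)%R -> asummable f.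
Proof.
move=> h; apply: (@le_lt_trans _ _ M%:E); last exact: ltry.
apply: ge_ereal_sup => _ [X [finX XI]] <-.
by rewrite fsbig_finite//= sumEFin lee_fin.
Qed.

Lemma esumr_fin_le T (f : T -> R) (M : \bar R) :
  (forall F : {fset T}, (\sum_(x <- F) f x)%:E <= M) -> esumr f <= M.
Proof.
move=> h; apply: ge_ereal_sup => _ [X [finX XI]] <-.
by rewrite fsbig_finite//= sumEFin.
Qed.

Lemma fset_esumr_le T (f : T -> R) (F : {fset T}) : (forall x, (0 <= f x)%R) ->
  (\sum_(x <- F) f x)%:E <= esumr f.
Proof.
move=> f0; apply: esum_ge; exists [set` F]; first by split.
rewrite fsbig_finite//= sumEFin lee_fin set_fsetK.
by [].
Qed.

End Ssum.

(** * Multisets and Poisson weights *)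

Section Multiset.
Context {I : choiceType}.
Implicit Types (m : mset I) (b : I).

Definition madd m b : mset I := [fsfun m with b |-> (m b).+1].
Definition msub m b : mset I := [fsfun m with b |-> (m b).-1].

Lemma maddE m b c : madd m b c = (m c + (c == b))%N.
Proof. by rewrite /madd fsfun_withE; case: eqP => [->|]; rewrite ?addn1 ?addn0. Qed.

Lemma msubE m b c : msub m b c = (m c - (c == b))%N.
Proof. by rewrite /msub fsfun_withE; case: eqP => [->|]; rewrite ?subn1 ?subn0. Qed.

Lemma maddK m b : msub (madd m b) b = m.
Proof. by apply/fsfunP => c; rewrite msubE maddE addnK. Qed.

Lemma msubK m b : (0 < m b)%N -> madd (msub m b) b = m.
Proof.
by move=> mb; apply/fsfunP => c; rewrite maddE msubE; case: eqP => [->|_]; lia.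
Qed.

(** The hypothesis matters at [b = c]: subtraction truncates, so with [m c = 0] the left side is [m]
    and the right side is [madd m b]. *)
Lemma msub_madd m b c : (0 < m c)%N -> msub (madd m b) c = madd (msub m c) b.
Proof.
move=> mc; apply/fsfunP => x; rewrite !(msubE, maddE).
by case: (eqVneq x c) => [->|]; case: eqP; lia.
Qed.

Lemma finsupp_madd m b : finsupp (madd m b) = (b |` finsupp m)%fset.
Proof. by rewrite /madd finsupp_with. Qed.

Lemma mem_finsupp_gt0 m b : (b \in finsupp m) = (0 < m b)%N.
Proof. by rewrite mem_finsupp lt0n. Qed.

Lemma mset0E b : ([fsfun] : mset I) b = 0%N.
Proof. by rewrite fsfunE. Qed.

Lemma mset_ind (P : mset I -> Prop) :
  P [fsfun] -> (forall m b, P m -> P (madd m b)) -> forall m, P m.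
Proof.
move=> P0 Pa m.
have [n] := ubnP (\sum_(b <- finsupp m) m b)%N.
elim: n m => // n IH m mn.
have [m0|[b bm]] := fset_0Vmem (finsupp m).
  suff -> : m = [fsfun] by [].
  by apply/fsfunP => b; rewrite mset0E fsfun_dflt// m0 inE.
have mb : (0 < m b)%N by rewrite -mem_finsupp_gt0.
rewrite -(msubK mb); apply: Pa; apply: IH.
have sub : (finsupp (msub m b) `<=` finsupp m)%fset.
  apply/fsubsetP => c; rewrite !mem_finsupp_gt0 msubE; lia.
have -> : (\sum_(c <- finsupp (msub m b)) msub m b c = \sum_(c <- finsupp m) msub m b c)%N.
  by apply: (big_fset_incl _ sub) => c _; apply: fsfun_dflt.
have e (k : I -> nat) : (\sum_(c <- finsupp m) k c = k b + \sum_(c <- (finsupp m `\ b)%fset) k c)%N.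
  exact: big_fsetD1.
have e1 : (\sum_(c <- (finsupp m `\ b)%fset) msub m b c = \sum_(c <- (finsupp m `\ b)%fset) m c)%N.
  by apply: eq_big_seq => c; rewrite !inE => /andP[/negbTE cb _]; rewrite msubE cb subn0.
by move: mn; rewrite (e m) (e (msub m b)) e1 msubE eqxx; lia.
Qed.

Lemma big_finsupp (T : Type) (idx : T) (op : Monoid.com_law idx) m (S : {fset I})
  (F : I -> nat -> T) : (forall b, F b 0%N = idx) -> (finsupp m `<=` S)%fset ->
  \big[op/idx]_(b <- finsupp m) F b (m b) = \big[op/idx]_(b <- S) F b (m b).
Proof.
by move=> F0 mS; apply: (big_fset_incl _ mS) => b bS bm; rewrite fsfun_dflt.
Qed.

End Multiset.

Section PoissonWeight.
Context {R : realType} {I : choiceType}.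
Implicit Types (m : mset I) (b : I) (nu : I -> R).

(** The Poisson law without its factor exp(- total intensity). *)
Definition pweight nu m : R := \prod_(b <- finsupp m) (nu b ^+ m b / (m b)`!%:R).

Lemma pweightE nu m (S : {fset I}) : (finsupp m `<=` S)%fset ->
  pweight nu m = \prod_(b <- S) (nu b ^+ m b / (m b)`!%:R).
Proof.
apply: (@big_finsupp _ _ _ _ m S (fun b k => nu b ^+ k / k`!%:R)) => b.
by rewrite expr0 fact0 divr1.
Qed.

Lemma pweight0 nu : pweight nu [fsfun] = 1.
Proof. by rewrite /pweight finsupp0 big_seq_fset0. Qed.

Lemma pweight_ge0 nu m : (forall b, 0 <= nu b) -> 0 <= pweight nu m.
Proof. by move=> nu0; apply: prodr_ge0 => b _; rewrite divr_ge0 ?exprn_ge0. Qed.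

Lemma pweight_gt0 nu m : (forall b, 0 < nu b) -> 0 < pweight nu m.
Proof. by move=> nu0; apply: prodr_gt0 => b _; rewrite divr_gt0 ?exprn_gt0 ?ltr0n ?fact_gt0. Qed.

(** Pointwise form of Mecke's formula: the multiplicity cancels the last factor of the factorial.
    Both the adjointness of creation and differentiation and the recursion for Poisson coefficients
    rest on it. *)
Lemma pweight_madd nu m b :
  (madd m b b)%:R * pweight nu (madd m b) = nu b * pweight nu m.
Proof.
rewrite (@pweightE nu m (finsupp (madd m b))); last first.
  by rewrite finsupp_madd fsubsetUr.
have bm : b \in finsupp (madd m b) by rewrite mem_finsupp_gt0 maddE eqxx addn1.
rewrite /pweight !(big_fsetD1 b bm) /= !mulrA; congr (_ * _); last first.
  apply: eq_big_seq => c; rewrite !inE => /andP[/negbTE cb _].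
  by rewrite maddE cb addn0.
rewrite maddE eqxx addn1 factS natrM exprS invfM.
by rewrite mulrACA mulfV ?pnatr_eq0// mul1r.
Qed.

Lemma pweight_sep nu m x : pweight nu m =
  nu x ^+ m x / (m x)`!%:R * pweight nu [fsfun m without x].
Proof.
rewrite (@pweightE nu m (x |` finsupp m)%fset) ?fsubsetUr//.
rewrite (big_fsetD1 x) /= ?fset1U1//; congr (_ * _).
rewrite (@pweightE nu _ ((x |` finsupp m) `\ x)%fset); last first.
  by rewrite (finsupp_without m x x) fsetSD// fsubsetUr.
apply: eq_big_seq => c; rewrite !inE => /andP[/negbTE cb _].
by rewrite /app_fswithout fsfun_withE cb.
Qed.

Lemma exp_ssum (x : R) : 0 <= x ->
  asummable (fun k => x ^+ k / k`!%:R) /\ ssum (fun k => x ^+ k / k`!%:R) = expR x.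
Proof.
move=> x0; have p0 k : 0 <= x ^+ k / k`!%:R by rewrite divr_ge0 ?exprn_ge0.
have E : esumr (fun k => x ^+ k / k`!%:R) = (expR x)%:E.
  rewrite /esumr -nneseries_esumT; last by move=> n; rewrite lee_fin.
  rewrite /expR -EFin_lim; last exact: is_cvg_series_exp_coeff.
  congr (limn _); apply/funext => n /=.
  by rewrite /series /= -sumEFin.
have s : asummable (fun k => x ^+ k / k`!%:R).
  rewrite /asummable [X in esumr X](_ : _ = (fun k => x ^+ k / k`!%:R)) ?E ?ltry//.
  by apply/funext => k; rewrite ger0_norm.
by split => //; apply: EFin_inj; rewrite ge0_ssum.
Qed.

Definition pweight_on nu (S : seq I) m : R :=
  if all (fun b => b \in S) (finsupp m) then pweight nu m else 0.

(** Induction on [S]: a multiset on [x :: S] is a multiplicity of [x] together with a multiset on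
    [S], so one exponential series factors out. *)
Lemma pweight_on_sum nu (S : seq I) : (forall b, 0 <= nu b) -> uniq S ->
  asummable (pweight_on nu S) /\ ssum (pweight_on nu S) = expR (\sum_(b <- S) nu b).
Proof.
move=> nu0; elim: S => [_|x S IH /= /andP[xS uS]].
  rewrite big_nil expR0.
  have h m : m != [fsfun] -> pweight_on nu [::] m = 0.
    rewrite /pweight_on; case: ifP => // /allP h /eqP[].
    apply/fsfunP => b; rewrite mset0E fsfun_dflt//.
    by apply/negP => /h.
  have [s ->] := ssum1 h; split => //.
  by rewrite /pweight_on finsupp0 pweight0.
have [sS eS] := IH uS.
have [s1 e1] := exp_ssum (nu0 x).
have [sp ep] := ssum_prod s1 sS.
rewrite big_cons expRD -e1 -eS -ep.
pose e (m : mset I) : nat * mset I := (m x, [fsfun m without x]).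
have ie : injective e.
  move=> m m' [h1 h2]; apply/fsfunP => c.
  have [->//|cx] := eqVneq c x.
  have /fsfunP/(_ c) := h2.
  by rewrite /app_fswithout !fsfun_withE (negbTE cx).
have fe m : pweight_on nu (x :: S) m =
    (fun p : nat * mset I => nu x ^+ p.1 / p.1`!%:R * pweight_on nu S p.2) (e m).
  rewrite /= /pweight_on (pweight_sep nu m x).
  have -> : all (fun b => b \in x :: S) (finsupp m) =
      all (fun b => b \in S) (finsupp [fsfun m without x]).
    rewrite (finsupp_without m x x); apply/idP/idP => /allP h; apply/allP => c.
      by rewrite !inE => /andP[cx /h]; rewrite !inE (negbTE cx).
    by move=> cm; rewrite !inE; have [//|cx/=] := eqVneq c x; apply: (h c); rewrite !inE cx.
  by case: ifP; rewrite ?mulr0.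
have fz (p : nat * mset I) : (forall m, e m <> p) ->
    nu x ^+ p.1 / p.1`!%:R * pweight_on nu S p.2 = 0.
  case: p => k m' /= h; rewrite /pweight_on; case: ifP; rewrite ?mulr0// => /allP a.
  case: (h [fsfun m' with x |-> k]); rewrite /e fsfun_with; congr pair.
  apply/fsfunP => c; rewrite /app_fswithout !fsfun_withE.
  case: eqP => // ->; rewrite fsfun_dflt//.
  by apply/negP => /a; rewrite (negbTE xS).
rewrite (funext fe); split; first by rewrite (asummable_reindex ie fz).
by rewrite (ssum_reindex ie fz).
Qed.

Theorem pweight_sum nu : (forall b, 0 <= nu b) -> asummable nu ->
  asummable (pweight nu) /\ ssum (pweight nu) = expR (ssum nu).
Proof.
move=> nu0 snu; have p0 m := pweight_ge0 m nu0.
have on_le S m : 0 <= pweight_on nu S m <= pweight nu m.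
  by rewrite /pweight_on; case: ifP; rewrite ?lexx ?p0.
(* Finitely many multisets live on the finite union of their supports, where the truncated sum is
   known. *)
have up (F : {fset mset I}) : \sum_(m <- F) pweight nu m <= expR (ssum nu).
  pose S : {fset I} := (\bigcup_(m <- F) finsupp m)%fset.
  have [sS eS] := pweight_on_sum nu0 (fset_uniq S).
  apply: (@le_trans _ _ (expR (\sum_(b <- S) nu b))); last first.
    by rewrite ler_expR -lee_fin ge0_ssum// fset_esumr_le.
  rewrite -eS -lee_fin ge0_ssum//; last by move=> m; case/andP: (on_le S m).
  apply: le_trans (fset_esumr_le F _); last by move=> m; case/andP: (on_le S m).
  rewrite lee_fin [leLHS]big_seq [leRHS]big_seq; apply: ler_sum => m mF.
  rewrite /pweight_on ifT//; apply/allP => b bm.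
  by apply/bigfcupP; exists m; rewrite ?mF.
have sw : asummable (pweight nu).
  apply: (@asummable_fin _ _ _ (expR (ssum nu))) => F.
  apply: le_trans (up F); apply: ler_sum => m _; by rewrite ger0_norm.
split => //; apply/eqP; rewrite eq_le; apply/andP; split.
  by rewrite -lee_fin ge0_ssum//; apply: esumr_fin_le => F; rewrite lee_fin.
(* Conversely every truncation is a lower bound; the logarithm turns these into bounds on the finite
   partial sums of [nu]. *)
have lo (F : {fset I}) : expR (\sum_(b <- F) nu b) <= ssum (pweight nu).
  have [sS eS] := pweight_on_sum nu0 (fset_uniq F).
  by rewrite -eS; apply: le_ssum => // m; case/andP: (on_le F m).
have w0 : 0 < ssum (pweight nu) by apply: lt_le_trans (lo fset0); rewrite expR_gt0.
rewrite -(lnK w0) ler_expR -lee_fin ge0_ssum//; apply: esumr_fin_le => F.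
by rewrite lee_fin -ler_expR lnK.
Qed.

End PoissonWeight.

(** * Charlier functions on Fock space *)

Lemma ssum_fset {R : realType} (T : choiceType) (f : T -> R) (S : {fset T}) :
  (forall x, x \notin S -> f x = 0) ->
  asummable f /\ ssum f = \sum_(x <- S) f x.
Proof.
move=> fz; pose D x y : R := if y == x then f x else 0.
have h x := @ssum1 R T x (D x).
have hD x : asummable (D x) /\ ssum (D x) = f x.
  by have := h x; rewrite {4}/D eqxx; apply=> y /negbTE yx; rewrite /D yx.
have -> : f = fun y => \sum_(x <- S) D x y.
  apply/funext => y; have [yS|yS] := boolP (y \in S).
    rewrite (big_fsetD1 y)//= {1}/D eqxx big_seq big1 ?addr0// => x.
    by rewrite !inE eq_sym /D => /andP[/negbTE ->].
  rewrite fz// big_seq big1// => x xS; rewrite /D; case: eqP => // yx.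
  by rewrite yx xS in yS.
split; first by apply: asummable_sum => x _; case: (hD x).
rewrite ssum_sum; last by move=> x _; case: (hD x).
rewrite [LHS]big_seq [RHS]big_seq; apply: eq_bigr => x xS; have [_ ->] := hD x.
rewrite (big_fsetD1 x)//= {1}/D eqxx big_seq big1 ?addr0// => y.
by rewrite !inE eq_sym /D => /andP[/negbTE ->].
Qed.

(** The witness [r] is the product over the indices other than [b], which adding [b] leaves
    unchanged. *)
Lemma mprod_madd {R : realType} {I : choiceType} (F : I -> nat -> R) (m : mset I) b :
  (forall c, F c 0%N = 1) -> exists r : R,
    \prod_(c <- finsupp m) F c (m c) = F b (m b) * r /\
    \prod_(c <- finsupp (madd m b)) F c (madd m b c) = F b (m b).+1 * r.
Proof.
move=> F0; exists (\prod_(c <- (finsupp (madd m b) `\ b)%fset) F c (m c)).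
have bm : b \in finsupp (madd m b) by rewrite mem_finsupp_gt0 maddE eqxx addn1.
split.
  rewrite (@big_finsupp _ _ _ _ m (finsupp (madd m b)) F)//; last first.
    by rewrite finsupp_madd fsubsetUr.
  by rewrite (big_fsetD1 b bm).
rewrite (big_fsetD1 b bm) /= maddE eqxx addn1; congr (_ * _).
apply: eq_big_seq => c; rewrite !inE => /andP[/negbTE cb _].
by rewrite maddE cb addn0.
Qed.

(** All ways to remove one position from a list, paired with what remains; repeated entries are
    listed repeatedly, as in the Leibniz rule. *)
Fixpoint picks {I : Type} (s : seq I) : seq (I * seq I) :=
  if s is x :: s' then (x, s') :: [seq (p.1, x :: p.2) | p <- picks s'] else [::].

Section Fock.
Context {R : realType} {I B : choiceType}.
Variables (g : B -> I -> R) (b0 : B) (lam : R).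
Hypothesis lam0 : 0 <= lam.
Implicit Types (m : mset B) (s : seq I).

(* Coordinates, in the monomials z^m / m!, of the vector obtained from the
   coherent state exp(- z_b0) by applying, for each tau in s, the shifted creation
   operator sum_b g b tau z_b + lam * g b0 tau. *)
Fixpoint fock (s : seq I) (m : mset B) : R :=
  if s is tau :: s' then
    \sum_(b <- finsupp m) g b tau * (m b)%:R * fock s' (msub m b)
    + lam * g b0 tau * fock s' m
  else \prod_(b <- finsupp m) (- (b == b0)%:R) ^+ m b.

(* The left-hand side is the derivative d/dz_b, which commutes with the creation
   operators up to scalars and has the coherent state as eigenvector. *)
Lemma fock_madd s m b : fock s (madd m b) =
  \sum_(p <- picks s) g b p.1 * fock p.2 m - (b == b0)%:R * fock s m.
Proof.
elim: s m b => [|tau s IH] m b.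
  rewrite big_nil sub0r /=.
  have [r [-> ->]] := @mprod_madd R B (fun c k => (- (c == b0)%:R) ^+ k) m b (fun c => expr0 _).
  by rewrite exprS !mulNr mulrA.
rewrite /= big_cons big_map /=.
set S := finsupp (madd m b).
have mS : (finsupp m `<=` S)%fset by rewrite /S finsupp_madd fsubsetUr.
have bS : b \in S by rewrite mem_finsupp_gt0 maddE eqxx addn1.
have red s' k : \sum_(c <- finsupp m) g c tau * (m c)%:R * fock s' (msub k c)
    = \sum_(c <- S) g c tau * (m c)%:R * fock s' (msub k c).
  by apply: (big_fset_incl _ mS) => c _ cm; rewrite fsfun_dflt// mulr0 mul0r.
(* The commutator: the extra unit in [madd m b c] matters only at [c = b] and yields the scalar
   [g b tau]. *)
have -> : \sum_(c <- S) g c tau * (madd m b c)%:R * fock s (msub (madd m b) c) =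
    g b tau * fock s m +
    \sum_(c <- S) g c tau * (m c)%:R * fock s (msub (madd m b) c).
  under eq_bigr do rewrite maddE natrD mulrDr mulrDl.
  rewrite big_split /= addrC; congr (_ + _).
  rewrite (big_fsetD1 b bS) /= eqxx mulr1 maddK big_seq big1 ?addr0// => c.
  by rewrite !inE => /andP[/negbTE -> _]; rewrite mulr0 mul0r.
have -> : \sum_(c <- S) g c tau * (m c)%:R * fock s (msub (madd m b) c) =
   \sum_(p <- picks s) g b p.1 * (\sum_(c <- finsupp m) g c tau * (m c)%:R * fock p.2 (msub m c))
   - (b == b0)%:R * (\sum_(c <- finsupp m) g c tau * (m c)%:R * fock s (msub m c)).
  rewrite red; under [in RHS]eq_bigr do rewrite red mulr_sumr.
  rewrite exchange_big /= mulr_sumr -sumrB; apply: eq_bigr => c _.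
  (* Only indices present in [m] contribute; for these removal and addition commute, so the
     induction hypothesis applies at [msub m c]. *)
  have [mc|mc] := posnP (m c).
    rewrite mc !(mulr0, mul0r) subr0 big1// => p _; by rewrite !(mulr0, mul0r).
  rewrite msub_madd// IH mulrBr mulr_sumr; congr (_ - _); last by ring.
  by apply: eq_bigr => p _; ring.
rewrite IH.
have -> : \sum_(j <- picks s) g b j.1 *
   (\sum_(b1 <- finsupp m) g b1 tau * (m b1)%:R * fock j.2 (msub m b1) +
    lam * g b0 tau * fock j.2 m) =
   \sum_(p <- picks s) g b p.1 * (\sum_(c <- finsupp m) g c tau * (m c)%:R * fock p.2 (msub m c))
   + lam * g b0 tau * \sum_(p <- picks s) g b p.1 * fock p.2 m.
  by rewrite mulr_sumr -big_split /=; apply: eq_bigr => p _; ring.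
ring.
Qed.

Variable gam : B -> R.
Hypothesis gam0 : forall b, 0 <= gam b.
Hypothesis sumR : forall tau tau', asummable (fun b => gam b * g b tau * g b tau').

Let w m : R := pweight (fun b => lam * gam b) m.
Let rho tau tau' := ssum (fun b => gam b * g b tau * g b tau').

(** Summand of the Fock scalar product with one-particle weights [lam * gam b]. Taking [gam = 1]
    will give completeness, [gam b = s^|b|] the correlated law. *)
Definition fock_term s s' m : R := w m * fock s m * fock s' m.
Definition fock_form s s' : R := ssum (fock_term s s').

Lemma fock_termC s s' : fock_term s s' = fock_term s' s.
Proof. by apply/funext => m; rewrite /fock_term mulrAC. Qed.

(** The signs of the coherent state square away and only powers of [b0] remain, leaving the
    exponential series in [lam * gam b0]. *)
Lemma fock_form_nil : asummable (fock_term [::] [::]) /\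
  fock_form [::] [::] = expR (lam * gam b0).
Proof.
pose nu b : R := lam * gam b * (b == b0)%:R.
have E : fock_term [::] [::] = pweight nu.
  apply/funext => m; rewrite /fock_term /w /= /pweight -!big_split /=.
  apply: eq_bigr => b _; rewrite /nu -mulrA -exprMn mulrNN -natrM mulnb andbb.
  by rewrite [in RHS]exprMn mulrAC.
have nu0 b : 0 <= nu b by rewrite !mulr_ge0.
have [s0 e0] : asummable nu /\ ssum nu = nu b0.
  by apply: ssum1 => b /negbTE bb; rewrite /nu bb mulr0.
rewrite /fock_form E; have [? ->] := pweight_sum nu0 s0; split => //.
by rewrite e0 /nu eqxx mulr1.
Qed.

(* Multiplication by z_b is adjoint to lam * gam b * d/dz_b: reindexing the sum by
   m = madd m' b moves the creation operator of tau onto [fock s']. *)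
Lemma fock_form_step tau s s' : asummable (fock_term s s') ->
  (forall p, p \in picks s' -> asummable (fock_term s p.2)) ->
  asummable (fock_term (tau :: s) s') /\
  fock_form (tau :: s) s' =
    \sum_(p <- picks s') lam * rho tau p.1 * fock_form s p.2
    + lam * (1 - gam b0) * g b0 tau * fock_form s s'.
Proof.
move=> h1 h2.
(* [H] is the creation part of the summand and [F] is [H] after the substitution [m = madd m' b];
   [T] and [D] come from the two terms of [fock_madd]. *)
pose F (q : mset B * B) : R :=
  w q.1 * (lam * gam q.2) * g q.2 tau * fock s q.1 * fock s' (madd q.1 q.2).
pose H (q : mset B * B) : R :=
  w q.1 * (g q.2 tau * (q.1 q.2)%:R * fock s (msub q.1 q.2)) * fock s' q.1.
pose T (p : I * seq I) (q : mset B * B) : R :=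
  fock_term s p.2 q.1 * (gam q.2 * g q.2 tau * g q.2 p.1).
pose D (b : B) : R := gam b * g b tau * (b == b0)%:R.
have [sD eD] : asummable D /\ ssum D = gam b0 * g b0 tau.
  have := @ssum1 R B b0 D; rewrite {4}/D eqxx mulr1; apply.
  by move=> b /negbTE bb; rewrite /D bb mulr0.
have FE q : F q = lam * (\sum_(p <- picks s') T p q)
    - lam * (fock_term s s' q.1 * D q.2).
  rewrite /F fock_madd mulrBr; congr (_ - _); last by rewrite /fock_term /D; ring.
  by rewrite !mulr_sumr; apply: eq_bigr => p _; rewrite /T /fock_term; ring.
have sT p : p \in picks s' -> asummable (T p) /\ ssum (T p) = fock_form s p.2 * rho tau p.1.
  by move=> /h2 hp; apply: (ssum_prod hp (sumR tau p.1)).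
have [sD2 eD2] := ssum_prod h1 sD.
have sST : asummable (fun q => \sum_(p <- picks s') T p q).
  by apply: asummable_sum => p /sT[].
have sF : asummable F.
  by rewrite (funext FE); apply: asummableB; apply: asummableZ.
have eF : ssum F = \sum_(p <- picks s') lam * rho tau p.1 * fock_form s p.2
   - lam * gam b0 * g b0 tau * fock_form s s'.
  rewrite (funext FE) ssumB; try exact: asummableZ.
  rewrite !ssumZ// eD2 eD ssum_sum; last by move=> p /sT[].
  rewrite mulr_sumr; congr (_ - _); last by rewrite /fock_form; ring.
  by apply: eq_big_seq => p /sT[_ ->]; ring.
pose e (q : mset B * B) := (madd q.1 q.2, q.2).
have ie : injective e.
  move=> [m b] [m' b'] h; have /= h1' := congr1 fst h; have /= h2' := congr1 snd h.
  by subst b'; rewrite -(maddK m b) h1' maddK.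
have HF q : H (e q) = F q.
  rewrite /H /F /e /= maddK.
  transitivity ((madd q.1 q.2 q.2)%:R * w (madd q.1 q.2) *
    (g q.2 tau * fock s q.1 * fock s' (madd q.1 q.2))); first by ring.
  by rewrite /w pweight_madd; ring.
have Hz q : (forall q', e q' <> q) -> H q = 0.
  case: q => m b h; rewrite /H /=.
  have [->|mb] := posnP (m b); first by rewrite mulr0 mul0r mulr0 mul0r.
  by case: (h (msub m b, b)); rewrite /e /= msubK.
have sH : asummable H by rewrite -(asummable_reindex ie Hz) (funext HF).
have eH : ssum H = ssum F by rewrite (ssum_reindex ie Hz) (funext HF).
have [sP eP] := ssum_pair sH.
have E : fock_term (tau :: s) s' = fun m => ssum (fun b => H (m, b)) +
    lam * g b0 tau * fock_term s s' m.
  apply/funext => m.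
  have [|_ ->] := @ssum_fset R B (fun b => H (m, b)) (finsupp m).
    by move=> b bm; rewrite /H /= fsfun_dflt// mulr0 mul0r mulr0 mul0r.
  rewrite /H /= -mulr_suml -mulr_sumr /fock_term /=; ring.
split; first by rewrite E; apply: asummableD => //; exact: asummableZ.
rewrite {1}/fock_form E ssumD//; last exact: asummableZ.
rewrite ssumZ// -eP eH eF -/(fock_form s s'); ring.
Qed.

(** First against the empty list, where no contraction occurs; symmetry then starts the induction
    for arbitrary [s']. *)
Lemma asummable_fock s s' : asummable (fock_term s s').
Proof.
have h0 q : asummable (fock_term q [::]).
  elim: q => [|tau q IH]; first by case: fock_form_nil.
  by case: (@fock_form_step tau q [::]).
elim: s s' => [s'|tau s IH s']; first by rewrite fock_termC.
by case: (@fock_form_step tau s s').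
Qed.

(** A Wick-type recursion: the new operator contracts with an entry of [s'] or acts as a scalar. The
    factor [1 - gam b0] combines the shift of the operator with the eigenvalue of the coherent
    state. *)
Lemma fock_form_cons tau s s' : fock_form (tau :: s) s' =
    \sum_(p <- picks s') lam * rho tau p.1 * fock_form s p.2
    + lam * (1 - gam b0) * g b0 tau * fock_form s s'.
Proof.
have [||_ //] := @fock_form_step tau s s'; first exact: asummable_fock.
by move=> p _; exact: asummable_fock.
Qed.

Lemma fock_formC s s' : fock_form s s' = fock_form s' s.
Proof. by rewrite /fock_form fock_termC. Qed.

End Fock.

(** * The Poisson side *)

Section Mecke.
Context {R : realType} {C J : choiceType}.
Variables (a : C -> J -> nat) (nu : C -> R).
Hypotheses (nu0 : forall i, 0 <= nu i) (snu : asummable nu).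
Implicit Types (w : mset C) (K : J -> nat).

Definition load w (j : J) : nat := \sum_(i <- finsupp w) a i j * w i.

Lemma load_madd w i j : load (madd w i) j = (a i j + load w j)%N.
Proof.
have iw : i \in finsupp (madd w i) by rewrite mem_finsupp_gt0 maddE eqxx addn1.
have sub : (finsupp w `<=` finsupp (madd w i))%fset by rewrite finsupp_madd fsubsetUr.
have e : load w j = (\sum_(c <- finsupp (madd w i)) a c j * w c)%N.
  by apply: (big_fset_incl _ sub) => c _ cw; rewrite fsfun_dflt// muln0.
rewrite e /load; under eq_bigr do rewrite maddE mulnDr.
rewrite big_split /= addnC; congr addn.
rewrite (big_fsetD1 i iw) /= eqxx muln1 big_seq big1 ?addn0// => c.
by rewrite !inE => /andP[/negbTE -> _]; rewrite muln0.
Qed.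

(** Unnormalised probability that the Poisson configuration has load [K]. *)
Definition pois_coef K : R :=
  ssum (fun w => if load w == K :> (J -> nat) then pweight nu w else 0).

Let T K w : R := if load w == K :> (J -> nat) then pweight nu w else 0.

Let sT K : asummable (T K).
Proof.
have [s _] := pweight_sum nu0 snu; apply: asummable_le s _ => w.
by rewrite /T; case: ifP => _; rewrite ?normr0 ?ger0_norm// pweight_ge0.
Qed.

Let T0 K w : 0 <= T K w.
Proof. by rewrite /T; case: ifP => // _; exact: pweight_ge0. Qed.

Lemma pois_coef_ge0 K : 0 <= pois_coef K.
Proof. exact: (ssum_ge0 (T0 K) (sT K)). Qed.

(* Mecke's formula: [w i * pweight w = nu i * pweight (w - i)], summed over the
   indices i charging j. *)
Lemma pois_coef_rec K j : (K j)%:R * pois_coef K =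
  ssum (fun i => (a i j)%:R * nu i *
    (if `[< forall j, (a i j <= K j)%N >] then pois_coef (fun j => K j - a i j)%N else 0)).
Proof.
pose H (q : mset C * C) : R := (a q.2 j * q.1 q.2)%:R * T K q.1.
have Hw w : asummable (fun i => H (w, i)) /\ ssum (fun i => H (w, i)) = (K j)%:R * T K w.
  have [|s ->] := @ssum_fset R C (fun i => H (w, i)) (finsupp w).
    by move=> i iw; rewrite /H /= fsfun_dflt// muln0 mul0r.
  split => //; rewrite /H /= -mulr_suml -natr_sum -/(load w j) /T.
  by case: eqP => [->//|_]; rewrite !mulr0.
have H0 q : 0 <= H q by rewrite mulr_ge0 ?T0.
have sH : asummable H.
  apply: asummable_pair => [w|]; first by case: (Hw w).
  rewrite [X in asummable X](_ : _ = fun w => (K j)%:R * T K w); first exact: asummableZ.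
  apply/funext => w; have [_ <-] := Hw w; apply: eq_ssum => i.
  by rewrite ger0_norm.
have eH : ssum H = (K j)%:R * pois_coef K.
  have [_ ->] := ssum_pair sH; rewrite /pois_coef -ssumZ; last exact: sT.
  apply: eq_ssum => w.
  by case: (Hw w).
pose e (q : C * mset C) := (madd q.2 q.1, q.1).
have ie : injective e.
  move=> [i w] [i' w'] h; have /= h1 := congr1 fst h; have /= h2 := congr1 snd h.
  by subst i'; rewrite -(maddK w i) h1 maddK.
have Hz q : (forall q', e q' <> q) -> H q = 0.
  case: q => w i h; rewrite /H /=.
  have [->|wi] := posnP (w i); first by rewrite muln0 mul0r.
  by case: (h (i, msub w i)); rewrite /e /= msubK.
have HeE i w : H (e (i, w)) = (a i j)%:R * nu i *
    (if `[< forall j, (a i j <= K j)%N >] then T (fun j => K j - a i j)%N w else 0).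
  rewrite /H /e /= /T natrM -[LHS]mulrA -[RHS]mulrA; congr (_ * _).
  (* Truncated subtraction loses the condition that [i] fits into [K], so it is kept as a separate
     test. *)
  have -> : (load (madd w i) == K :> (J -> nat)) =
     `[< forall j, (a i j <= K j)%N >] && (load w == (fun j => K j - a i j)%N :> (J -> nat)).
    apply/eqP/andP => [<-|[/asboolP h /eqP h2]].
      split; first by apply/asboolP => k; rewrite load_madd leq_addr.
      by apply/eqP/funext => k; rewrite load_madd addKn.
    by apply/funext => k; rewrite load_madd h2 subnKC.
  case: asboolP => _ /=; last by rewrite !mulr0.
  by case: ifP => _; rewrite ?mulr0// pweight_madd.
have sHe : asummable (fun q => H (e q)) by rewrite (asummable_reindex ie Hz).
rewrite -eH (ssum_reindex ie Hz); have [_ ->] := ssum_pair sHe.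
apply: eq_ssum => i; under eq_ssum do rewrite HeE.
case: asboolP => h; first by rewrite ssumZ.
by under eq_ssum do rewrite mulr0; rewrite ssum0 mulr0.
Qed.

Lemma pois_coef0 : (forall i, exists j, (0 < a i j)%N) -> pois_coef (fun=> 0%N) = 1.
Proof.
move=> ha; rewrite /pois_coef.
have h w : w != [fsfun] -> T (fun=> 0%N) w = 0.
  move=> w0; rewrite /T; case: eqP => // lw; case/eqP: w0.
  apply/fsfunP => i; rewrite mset0E; apply/eqP; rewrite -leqn0 leqNgt; apply/negP => wi.
  have [j aj] := ha i.
  move/(congr1 (fun f => f j)): lw; rewrite -(msubK wi) load_madd; lia.
have [_ ->] := ssum1 h; rewrite /T pweight0 ifT//; apply/eqP/funext => j.
by rewrite /load finsupp0 big_seq_fset0.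
Qed.

End Mecke.

(** * Multisets as lists up to permutation *)

Section MsetOf.
Context {I : choiceType}.
Implicit Types (N : mset I) (s : seq I).

Definition mset_of s : mset I := foldr (fun x N => madd N x) [fsfun] s.

Lemma mset_of_surj N : exists s, mset_of s == N.
Proof.
elim/(@mset_ind I): N => [|N b [s /eqP <-]]; first by exists [::].
by exists (b :: s).
Qed.

(** Operators are applied along lists while trees are multisets, so an enumeration in an arbitrary
    order is fixed by choice. *)
Definition seq_of N : seq I := xchoose (mset_of_surj N).

Lemma seq_ofK N : mset_of (seq_of N) = N.
Proof. exact/eqP/(xchooseP (mset_of_surj N)). Qed.

(** An element of multiplicity k occupies k positions, which turns sums over positions into weighted
    sums over the support. *)
Lemma sum_picks {R : realType} (F : I -> mset I -> R) s :
  \sum_(p <- picks s) F p.1 (mset_of p.2) =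
  \sum_(x <- finsupp (mset_of s)) (mset_of s x)%:R * F x (msub (mset_of s) x).
Proof.
elim: s F => [|y s IH] F; first by rewrite big_nil finsupp0 big_seq_fset0.
rewrite /= big_cons big_map /= (IH (fun x N => F x (madd N y))).
set N := mset_of s; set S := finsupp (madd N y).
have NS : (finsupp N `<=` S)%fset by rewrite /S finsupp_madd fsubsetUr.
have yS : y \in S by rewrite mem_finsupp_gt0 maddE eqxx addn1.
under [in RHS]eq_bigr do rewrite maddE natrD mulrDl.
rewrite big_split /= addrC; congr (_ + _).
  rewrite (big_fsetD1 y yS) /= eqxx mul1r maddK big_seq big1 ?addr0// => c.
  by rewrite !inE => /andP[/negbTE -> _]; rewrite mul0r.
rewrite [LHS](big_fset_incl _ NS) => [|c _ cN]; last by rewrite fsfun_dflt// mul0r.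
apply: eq_bigr => c _; have [->|Nc] := posnP (N c); first by rewrite !mul0r.
by rewrite msub_madd.
Qed.

Definition mfact {R : realType} N : R := \prod_(c <- finsupp N) (N c)`!%:R.

Lemma mfact_madd {R : realType} N b : mfact (madd N b) = (madd N b b)%:R * mfact N :> R.
Proof.
have [r [e1 e2]] := @mprod_madd R I (fun _ k => k`!%:R) N b (fun=> erefl).
by rewrite /mfact e1 e2 maddE eqxx addn1 factS natrM mulrA.
Qed.

Lemma mfact0 {R : realType} : mfact [fsfun] = 1 :> R.
Proof. by rewrite /mfact finsupp0 big_seq_fset0. Qed.

Lemma mfact_gt0 {R : realType} N : 0 < mfact N :> R.
Proof. by apply: prodr_gt0 => c _; rewrite ltr0n fact_gt0. Qed.

End MsetOf.

(** * Coefficients of Poisson configurations with two marginals *)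

Section Bipartite.
Context {R : realType} {I : choiceType}.
Variables (del : I -> R) (A : I * I -> R).
Hypotheses (del0 : forall i, 0 <= del i) (A0 : forall p, 0 <= A p).
Notation C := ((I + I) + (I * I))%type.

Definition bip_nu (i : C) : R :=
  match i with
  | inl (inl tau) => del tau
  | inl (inr tau) => del tau
  | inr p => A p
  end.

(* [inl x] and [inr y] stand for the coordinates N_x and N'_y; the index [inr p]
   of M_p charges one coordinate on each side. *)
Definition bip_inc (i : C) (j : (I + I)%type) : nat :=
  match i with
  | inl k => (j == k)
  | inr p => (j == inl p.1) || (j == inr p.2)
  end.

Definition bip_load (N N' : mset I) (j : (I + I)%type) : nat :=
  match j with inl x => N x | inr x => N' x end.

Hypothesis snu : asummable bip_nu.

Lemma bip_nu_ge0 i : 0 <= bip_nu i.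
Proof. by case: i => [[]|] /=. Qed.

Definition bip_coef (N N' : mset I) : R := pois_coef bip_inc bip_nu (bip_load N N').

(** Mecke's formula at the coordinate [inl x]: the particle removed is either Delta_x or some
    M_(x,y) with y present in [N']. *)
Lemma bip_coef_rec N N' x : (madd N x x)%:R * bip_coef (madd N x) N' =
  del x * bip_coef N N' + \sum_(y <- finsupp N') A (x, y) * bip_coef N (msub N' y).
Proof.
have := pois_coef_rec bip_inc bip_nu_ge0 snu (bip_load (madd N x) N') (inl x).
rewrite [bip_load _ _ _]/= => ->.
set f : C -> R := fun i => _.
pose S : {fset C} := (inl (inl x) |` [fset inr (x, y) | y in finsupp N'])%fset.
have [|_ ->] := @ssum_fset R _ f S.
  case=> [[y|y]|[y z]] h; rewrite /f /=.
  - case: eqP => [[xy]|_]; last by rewrite !mul0r.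
    by move: h; rewrite -xy !inE eqxx.
  - by rewrite !mul0r.
  - rewrite orbF; case: eqP => [[xy]|_]; last by rewrite !mul0r.
    case: asboolP => [/(_ (inr z))|_]; last by rewrite mulr0.
    rewrite /= eqxx => Nz; move: h; rewrite -xy !inE /=.
    by rewrite in_imfset// mem_finsupp_gt0.
rewrite big_fsetU1/=; last first.
  by apply/negP => /imfsetP[y _].
congr (_ + _).
  rewrite /f /= eqxx mul1r; congr (_ * _); rewrite ifT.
    congr pois_coef; apply/funext => -[c|c] /=; last by rewrite subn0.
    by rewrite maddE (inj_eq inl_inj) addnK.
  by apply/asboolP => -[c|c] //=; rewrite maddE (inj_eq inl_inj) leq_addl.
rewrite big_imfset/=; last by move=> y z _ _ [].
rewrite [LHS]big_seq [RHS]big_seq; apply: eq_bigr => y; rewrite mem_finsupp_gt0 => Ny.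
rewrite /f /= eqxx mul1r; congr (_ * _); rewrite ifT.
  congr pois_coef; apply/funext => -[c|c] /=.
    by rewrite orbF maddE (inj_eq inl_inj) addnK.
  by rewrite msubE (inj_eq inr_inj).
apply/asboolP => -[c|c] /=; first by rewrite orbF maddE (inj_eq inl_inj) leq_addl.
by rewrite (inj_eq inr_inj); case: eqP => // ->.
Qed.

(** With an empty left side no particle of type M fits, so only Delta'_y can be removed. *)
Lemma bip_coef_rec0 N' y : (madd N' y y)%:R * bip_coef [fsfun] (madd N' y) =
  del y * bip_coef [fsfun] N'.
Proof.
have := pois_coef_rec bip_inc bip_nu_ge0 snu (bip_load [fsfun] (madd N' y)) (inr y).
rewrite [bip_load _ _ _]/= => ->.
set f : C -> R := fun i => _.
have [|_ ->] := @ssum1 R _ (inl (inr y) : C) f.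
  case=> [[z|z]|[z z']] h; rewrite /f /=.
  - by rewrite !mul0r.
  - by case: eqP => [[yz]|_]; [rewrite yz eqxx in h | rewrite !mul0r].
  - case: asboolP => [/(_ (inl z))|_]; last by rewrite mulr0.
    by rewrite /= eqxx mset0E.
rewrite /f /= eqxx mul1r; congr (_ * _); rewrite ifT.
  congr pois_coef; apply/funext => -[c|c] /=; first by rewrite subn0.
  by rewrite maddE (inj_eq inr_inj) addnK.
by apply/asboolP => -[c|c] //=; rewrite maddE (inj_eq inr_inj) leq_addl.
Qed.

Lemma bip_coef00 : bip_coef [fsfun] [fsfun] = 1.
Proof.
rewrite /bip_coef (_ : bip_load _ _ = fun=> 0%N); last first.
  by apply/funext => -[c|c] /=; rewrite mset0E.
apply: pois_coef0 => -[k|p]; first by exists k; rewrite /= eqxx.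
by exists (inl p.1); rewrite /= eqxx.
Qed.

(** The factorials absorb the multiplicity on the left of [bip_coef_rec], giving a recursion along
    lists of the same shape as [fock_form_cons]. *)
Definition bip_form s s' : R :=
  mfact (mset_of s) * mfact (mset_of s') * bip_coef (mset_of s) (mset_of s').

Lemma bip_form_cons x s s' : bip_form (x :: s) s' =
  \sum_(p <- picks s') A (x, p.1) * bip_form s p.2 + del x * bip_form s s'.
Proof.
rewrite {1}/bip_form /= mfact_madd.
transitivity (mfact (mset_of s) * mfact (mset_of s') *
   ((madd (mset_of s) x x)%:R * bip_coef (madd (mset_of s) x) (mset_of s'))); first by ring.
rewrite bip_coef_rec mulrDr addrC /bip_form; congr (_ + _); last by ring.
rewrite (sum_picks (fun y N => A (x, y) * (mfact (mset_of s) * mfact N * bip_coef (mset_of s) N))).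
rewrite mulr_sumr [LHS]big_seq [RHS]big_seq; apply: eq_bigr => y; rewrite mem_finsupp_gt0 => Ny.
rewrite -{1}(msubK Ny) mfact_madd msubK//; ring.
Qed.

Lemma bip_form_nil y s' : bip_form [::] (y :: s') = del y * bip_form [::] s'.
Proof.
rewrite /bip_form /= mfact_madd.
transitivity (mfact ([fsfun] : mset I) * mfact (mset_of s') *
   ((madd (mset_of s') y y)%:R * bip_coef [fsfun] (madd (mset_of s') y))); first by ring.
by rewrite bip_coef_rec0; ring.
Qed.

End Bipartite.

Lemma ssum_split {R : realType} (T U : choiceType) (f : T + U -> R) :
  asummable (fun t => f (inl t)) -> asummable (fun u => f (inr u)) ->
  asummable f /\ ssum f = ssum (fun t => f (inl t)) + ssum (fun u => f (inr u)).
Proof.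
move=> sl sr.
pose fl (x : T + U) : R := if x is inl _ then f x else 0.
pose fr (x : T + U) : R := if x is inr _ then f x else 0.
have zl y : (forall t, inl t <> y) -> fl y = 0 by case: y => // t /(_ t).
have zr y : (forall t, inr t <> y) -> fr y = 0 by case: y => // t /(_ t).
have il : injective (@inl T U) by move=> ? ? [].
have ir : injective (@inr T U) by move=> ? ? [].
have sl' : asummable fl by rewrite -(asummable_reindex il zl).
have sr' : asummable fr by rewrite -(asummable_reindex ir zr).
have E : f = fun x => fl x + fr x.
  by apply/funext => -[] x; rewrite /fl /fr ?addr0 ?add0r.
split; first by rewrite E; exact: asummableD.
by rewrite {1}E ssumD// (ssum_reindex il zl) (ssum_reindex ir zr).
Qed.

Section Poisson.
Context {R : realType} {I : countType}.
Variable nu : I -> R.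
Hypotheses (nu0 : forall i, 0 <= nu i) (snu : asummable nu).

Lemma ppoisE n : ppois nu n = expR (- ssum nu) * pweight nu n.
Proof. by rewrite /ppois -/(esumr nu) -ge0_ssum. Qed.

Lemma ppois_sum : asummable (ppois nu) /\ ssum (ppois nu) = 1.
Proof.
have [s e] := pweight_sum nu0 snu.
have -> : ppois nu = fun n => expR (- ssum nu) * pweight nu n.
  by apply/funext => n; exact: ppoisE.
split; first exact: asummableZ.
by rewrite ssumZ// e -expRD addNr expR0.
Qed.

End Poisson.

Lemma ppois_gt0 {R : realType} {I : countType} (nu : I -> R) n :
  (forall i, 0 < nu i) -> 0 < ppois nu n.
Proof. by move=> nu0; rewrite /ppois mulr_gt0 ?expR_gt0//; exact: pweight_gt0. Qed.

Section BipartiteMass.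
Context {R : realType} {I : choiceType}.
Variables (del : I -> R) (A : I * I -> R).
Hypotheses (del0 : forall i, 0 <= del i) (A0 : forall p, 0 <= A p).
Hypotheses (sdel : asummable del) (sA : asummable A).

Lemma bip_nu_sum : asummable (bip_nu del A) /\
  ssum (bip_nu del A) = ssum del + ssum del + ssum A.
Proof.
have [s1 e1] := @ssum_split R I I (fun k => bip_nu del A (inl k)) sdel sdel.
by have [s2 ->] := @ssum_split R _ _ (bip_nu del A) s1 sA; rewrite e1.
Qed.

(* Existence of the pair of trees read off from [w]; it is unique, hence the
   coefficients [bip_coef] partition the total mass of the Poisson family. *)
Lemma bip_load_surj (w : mset ((I + I) + (I * I))%type) :
  exists q : mset I * mset I, load bip_inc w = bip_load q.1 q.2.
Proof.
elim/(@mset_ind ((I + I) + (I * I))%type): w => [|w i [[N N'] h]].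
  exists ([fsfun], [fsfun]); apply/funext => j.
  by rewrite /load finsupp0 big_seq_fset0; case: j => x /=; rewrite mset0E.
have E N1 N1' : (forall j, (bip_inc i j + bip_load N N' j)%N = bip_load N1 N1' j) ->
    exists q : mset I * mset I, load bip_inc (madd w i) = bip_load q.1 q.2.
  by move=> e; exists (N1, N1'); apply/funext => j; rewrite load_madd h e.
case: i E => [[x|x]|[x y]] E.
- apply: (E (madd N x) N') => -[z|z] //=; by rewrite maddE (inj_eq inl_inj) addnC.
- apply: (E N (madd N' x)) => -[z|z] //=; by rewrite maddE (inj_eq inr_inj) addnC.
- apply: (E (madd N x) (madd N' y)) => -[z|z] /=.
    by rewrite maddE (inj_eq inl_inj) orbF addnC.
  by rewrite maddE (inj_eq inr_inj) addnC.
Qed.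

Lemma bip_coef_sum :
  asummable (fun q : mset I * mset I => bip_coef del A q.1 q.2) /\
  ssum (fun q : mset I * mset I => bip_coef del A q.1 q.2) =
  expR (ssum del + ssum del + ssum A).
Proof.
have [snu <-] := bip_nu_sum.
have [sw <-] := pweight_sum (bip_nu_ge0 del0 A0) snu.
pose F (q : (mset I * mset I) * mset ((I + I) + (I * I))%type) : R :=
  if load bip_inc q.2 == bip_load q.1.1 q.1.2 :> (I + I -> nat)
  then pweight (bip_nu del A) q.2 else 0.
have [pr prE] := choice bip_load_surj.
(* [F] lives on the graph of [pr]: inner sums over configurations give the coefficients, and
   reindexing by the graph gives the total Poisson weight. *)
pose e w := (pr w, w).
have ie : injective e by move=> w w' /(congr1 snd).
have Fe w : F (e w) = pweight (bip_nu del A) w by rewrite /F /= prE eqxx.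
have Fz q : (forall w, e w <> q) -> F q = 0.
  case: q => q w h; rewrite /F /=; case: eqP => // lw; case: (h w).
  rewrite /e; congr pair; move: lw; rewrite prE => lw.
  case: q {h} lw => N N' lw; rewrite [pr w]surjective_pairing; congr pair.
    by apply/fsfunP => x; have /(congr1 (fun f => f (inl x))) := lw.
  by apply/fsfunP => x; have /(congr1 (fun f => f (inr x))) := lw.
have sF : asummable F by rewrite -(asummable_reindex ie Fz) (funext Fe).
have [s1 e1] := ssum_pair sF; split; first exact: s1.
by rewrite -[LHS]e1 (ssum_reindex ie Fz) (funext Fe).
Qed.

End BipartiteMass.

(** * The Galton-Watson and correlated tree laws *)

Section Trees.
Context {R : realType}.
Variables (lam s : R).
Hypotheses (lam0 : 0 < lam) (s0 : 0 <= s) (s1 : s <= 1).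

Lemma GW_gt0 d (t : X d) : 0 < GW lam d t.
Proof.
elim: d t => [//|d IH] t /=; apply: ppois_gt0 => x.
by rewrite mulr_gt0.
Qed.

Lemma GW_sum d : asummable (GW lam d : X d -> R) /\ ssum (GW lam d : X d -> R) = 1.
Proof.
elim: d => [|d [IH _]] /=.
  have [|s2 e] := @ssum1 R unit tt (fun=> 1); first by case.
  by split.
apply: (@ppois_sum R (X d)) => [i|]; first by rewrite mulr_ge0// ltW// GW_gt0.
exact: asummableZ.
Qed.

Definition tree_del d (x : X d) : R := lam * (1 - s) * GW lam d x.
Definition tree_cor d (p : X d * X d) : R := lam * s * corr lam s d p.

(** Turns the decomposition of the children counts into a load condition, so that the correlated law
    becomes a Poisson coefficient. *)
Lemma cmatchE d (w : mset (cidx d)) (t t' : X d.+1) :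
  `[< @cmatch d w t t' >] = (load bip_inc w == bip_load t t' :> (X d + X d -> nat)).
Proof.
have single (x : cidx d) : (\sum_(i <- finsupp w) (i == x) * w i = w x)%N.
  have [xw|xw] := boolP (x \in finsupp w).
    rewrite (big_fsetD1 x xw) /= eqxx mul1n big_seq big1 ?addn0// => i.
    by rewrite !inE => /andP[/negbTE -> _].
  rewrite fsfun_dflt// big_seq big1// => i iw; case: eqP => // ix.
  by rewrite -ix iw in xw.
have lr x : load bip_inc w (inl x) = (w (inl (inl x)) + @rowsum d w x)%N.
  rewrite -single /rowsum -big_split /=; apply: eq_bigr => -[[y|y]|[y z]] _ /=.
  - by rewrite addn0 (inj_eq inl_inj) (inj_eq inl_inj) eq_sym.
  - by [].
  - by rewrite orbF (inj_eq inl_inj) eq_sym; case: eqP => _; rewrite ?mul1n.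
have lc x : load bip_inc w (inr x) = (w (inl (inr x)) + @colsum d w x)%N.
  rewrite -single /colsum -big_split /=; apply: eq_bigr => -[[y|y]|[y z]] _ /=.
  - by [].
  - by rewrite addn0 (inj_eq inl_inj) (inj_eq inr_inj) eq_sym.
  - by rewrite (inj_eq inr_inj) eq_sym; case: eqP => _; rewrite ?mul1n.
apply/asboolP/eqP => [[h1 h2]|h].
  by apply/funext => -[x|x]; rewrite ?lr ?lc /= ?h1 ?h2.
split => x; first by rewrite -lr h.
by rewrite -lc h.
Qed.

(** The exponent is the total intensity: [lam * (1 - s)] for each of the two Delta families plus
    [lam * s] for M, by mass one at depth [d]. *)
Lemma corrS d (q : X d.+1 * X d.+1) :
  (forall p, 0 <= corr lam s d p) -> asummable (corr lam s d) -> ssum (corr lam s d) = 1 ->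
  corr lam s d.+1 q = expR (- (lam * (2 - s))) * bip_coef (@tree_del d) (@tree_cor d) q.1 q.2.
Proof.
move=> c0 sc ec; have [sG eG] := GW_sum d.
have del0 x : 0 <= @tree_del d x.
  by rewrite !mulr_ge0 ?subr_ge0// ltW// GW_gt0.
have A0 p : 0 <= @tree_cor d p by rewrite !mulr_ge0// ltW.
have sdel : asummable (@tree_del d) by exact: asummableZ.
have sA : asummable (@tree_cor d) by exact: asummableZ.
have [snu enu] := bip_nu_sum sdel sA.
have LE : ssum (bip_nu (@tree_del d) (@tree_cor d)) = lam * (2 - s).
  by rewrite enu /tree_del /tree_cor !ssumZ// eG ec; ring.
have nu0 := bip_nu_ge0 del0 A0.
rewrite /= -/(@tree_del d) -/(@tree_cor d).
rewrite [X in fine (\esum_(w in _) (ppois X w)%:E)](_ : _ =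
  bip_nu (@tree_del d) (@tree_cor d)); last first.
  by apply/funext => -[[]|].
have [sw _] := pweight_sum nu0 snu.
pose f w : R := expR (- (lam * (2 - s))) *
  (if load bip_inc w == bip_load q.1 q.2 :> (X d + X d -> nat)
   then pweight (bip_nu (@tree_del d) (@tree_cor d)) w else 0).
have f0 w : 0 <= f w.
  by rewrite mulr_ge0 ?expR_ge0//; case: ifP => // _; exact: pweight_ge0.
have sT : asummable (fun w => if load bip_inc w == bip_load q.1 q.2 :> (X d + X d -> nat)
   then pweight (bip_nu (@tree_del d) (@tree_cor d)) w else 0).
  apply: asummable_le sw _ => w; case: ifP => _; last by rewrite normr0 pweight_ge0.
  by rewrite ger0_norm// pweight_ge0.
rewrite esum_mkcond (_ : \esum_(i in _) _ = esumr f).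
  rewrite -ge0_ssum//; last exact: asummableZ.
  by rewrite /f ssumZ.
apply: eq_esum => w _; rewrite (ppoisE nu0 snu) LE.
rewrite (_ : (w \in _) = `[< @cmatch d w q.1 q.2 >]); last first.
  by apply/idP/asboolP; rewrite inE.
by rewrite cmatchE /f; case: ifP => _; rewrite ?mulr0.
Qed.

(** The three properties are proved together, since [corrS] consumes all of them at the previous
    depth. *)
Lemma corr_law d : [/\ forall p, 0 <= corr lam s d p, asummable (corr lam s d)
  & ssum (corr lam s d) = 1].
Proof.
elim: d => [|d [c0 sc ec]].
  split => //; have [|s2 e] := @ssum1 R (unit * unit)%type (tt, tt) (fun=> 1) => //;
  by case=> [[] []].
have [sG eG] := GW_sum d.
have del0 x : 0 <= @tree_del d x.
  by rewrite !mulr_ge0 ?subr_ge0// ltW// GW_gt0.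
have A0 p : 0 <= @tree_cor d p by rewrite !mulr_ge0// ltW.
have sdel : asummable (@tree_del d) by exact: asummableZ.
have sA : asummable (@tree_cor d) by exact: asummableZ.
have [snu _] := bip_nu_sum sdel sA.
have [sb eb] := bip_coef_sum del0 A0 sdel sA.
have E := fun q => @corrS d q c0 sc ec.
split.
- by move=> q; rewrite E mulr_ge0 ?expR_ge0// pois_coef_ge0// => i; exact: bip_nu_ge0.
- by rewrite (funext E); exact: asummableZ.
- rewrite (funext E) ssumZ// eb -expRD /tree_del /tree_cor !ssumZ// eG ec.
  by rewrite [X in expR X](_ : _ = 0) ?expR0//; ring.
Qed.

End Trees.

(** * Spectral decomposition of the correlated law *)

Definition leaf (d : nat) : X d :=
  match d return X d with 0 => tt | d'.+1 => [fsfun] end.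

Lemma tsize_leaf d : tsize d (leaf d) = 1%N.
Proof. by case: d => //= d; rewrite finsupp0 big_seq_fset0. Qed.

Lemma tsize_gt0 d (t : X d) : (0 < tsize d t)%N.
Proof. by case: d t. Qed.

Lemma pweightM {R : realType} {I : choiceType} (nu f : I -> R) (m : mset I) :
  pweight (fun b => nu b * f b) m = pweight nu m * \prod_(b <- finsupp m) f b ^+ m b.
Proof.
rewrite /pweight -big_split /=; apply: eq_bigr => b _.
by rewrite exprMn mulrAC.
Qed.

Section Spectral.
Context {R : realType}.
Variables (lam s : R).
Hypotheses (lam0 : 0 < lam) (s0 : 0 <= s) (s1 : s <= 1).

(* [g b t] is GW(t) f_b(t); the third clause is the completeness of the f_b, their
   orthogonality is not needed. *)
Definition spectral d (g : X d -> X d -> R) : Prop :=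
  [/\ forall t, g (leaf d) t = GW lam d t,
      forall t t', asummable (fun b => g b t * g b t'),
      forall t t', ssum (fun b => g b t * g b t') = if t == t' then GW lam d t else 0
    & forall t t', ssum (fun b => s ^+ (tsize d b).-1 * g b t * g b t') =
        corr lam s d (t, t')].

Section Step.
Variables (d : nat) (g : X d -> X d -> R).
Hypothesis gP : spectral g.

(** [gam1] serves completeness, [gam2] the correlated law. The exponent is the full size, since a
    child subtree [b] adds all its nodes to the tree of depth [d.+1]. *)
Let gam1 (b : X d) : R := 1.
Let gam2 (b : X d) : R := s ^+ tsize d b.
Let lam_ge0 : 0 <= lam := ltW lam0.
Let F1 := fock_form g (leaf d) lam gam1.
Let F2 := fock_form g (leaf d) lam gam2.

Let gam2E t t' b : gam2 b * g b t * g b t' =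
  s * (s ^+ (tsize d b).-1 * g b t * g b t').
Proof. by rewrite /gam2 !mulrA -exprS prednK ?tsize_gt0. Qed.

Let sum_s t t' : asummable (fun b => s ^+ (tsize d b).-1 * g b t * g b t').
Proof.
case: gP => _ h _ _; apply: asummable_le (asummable_abs (h t t')) _ => b.
rewrite -mulrA normrM ler_piMl// ger0_norm ?exprn_ge0//.
exact: exprn_ile1.
Qed.

Let sum1 t t' : asummable (fun b => gam1 b * g b t * g b t').
Proof.
by under eq_fun do rewrite mul1r; case: gP.
Qed.

Let sum2 t t' : asummable (fun b => gam2 b * g b t * g b t').
Proof. by under eq_fun do rewrite gam2E; exact: asummableZ. Qed.

Let gam1_0 b : 0 <= gam1 b. Proof. exact: ler01. Qed.
Let gam2_0 b : 0 <= gam2 b. Proof. exact: exprn_ge0. Qed.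

(** Both sides obey one recursion: contraction gives the intensity of M by the last clause of
    [spectral], and the scalar term gives that of Delta. *)
Lemma spectral_form2 q q' : F2 q q' =
  expR (lam * s) * bip_form (@tree_del R lam s d) (@tree_cor R lam s d) q q'.
Proof.
have [c0 sc ec] := corr_law lam0 s0 s1 d.
have [sG eG] := GW_sum lam0 d.
have del0 x : 0 <= @tree_del R lam s d x.
  by rewrite !mulr_ge0 ?subr_ge0// ltW// GW_gt0.
have A0 p : 0 <= @tree_cor R lam s d p by rewrite !mulr_ge0.
have sdel : asummable (@tree_del R lam s d) by exact: asummableZ.
have sA : asummable (@tree_cor R lam s d) by exact: asummableZ.
have [snu _] := bip_nu_sum sdel sA.
case: gP => gl _ _ gc.
(* A leaf has one node, so [1 - gam2] there is [1 - s], as in the intensity of Delta. *)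
have g20 : gam2 (leaf d) = s by rewrite /gam2 tsize_leaf.
have cons x r r' : F2 (x :: r) r' =
    \sum_(p <- picks r') tree_cor lam s (x, p.1) * F2 r p.2 + tree_del lam s x * F2 r r'.
  rewrite /F2 fock_form_cons// g20 gl -/F2; congr (_ + _).
  apply: eq_bigr => p _; congr (_ * _).
  transitivity (lam * (s * corr lam s d (x, p.1))); last by rewrite mulrA.
  congr (_ * _); rewrite -gc -ssumZ//.
  by apply: eq_ssum => b; rewrite gam2E.
have nil r : F2 r [::] = expR (lam * s) *
    bip_form (@tree_del R lam s d) (@tree_cor R lam s d) [::] r.
  elim: r => [|x r IH].
    rewrite /F2; have [_ ->] := @fock_form_nil R _ _ g (leaf d) lam lam_ge0 gam2 gam2_0.
    by rewrite g20 /bip_form /= mfact0 bip_coef00// !mulr1.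
  by rewrite cons big_nil add0r IH bip_form_nil//; ring.
elim: q q' => [q'|x q IH q'].
  by rewrite /F2 fock_formC -/F2 nil.
rewrite cons IH bip_form_cons// [RHS]mulrDr mulr_sumr; congr (_ + _); last by ring.
by apply: eq_bigr => p _; rewrite IH; ring.
Qed.

Let pg (N : mset (X d)) : R := pweight (fun x => lam * GW lam d x) N.

(** For weight one the scalar term of the recursion vanishes and contraction pairs only equal
    entries, so the form is diagonal in the multiset. *)
Lemma spectral_form1 q q' : F1 q q' =
  if mset_of q == mset_of q' then expR lam * (mfact (mset_of q) ^+ 2 * pg (mset_of q)) else 0.
Proof.
case: gP => gl _ go _.
have cons x r r' : F1 (x :: r) r' =
    \sum_(p <- picks r') lam * (if x == p.1 then GW lam d x else 0) * F1 r p.2.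
  rewrite /F1 fock_form_cons// -/F1 /gam1 subrr mulr0 mul0r mul0r addr0.
  apply: eq_bigr => p _; congr (_ * _ * _); rewrite -go.
  by apply: eq_ssum => b; rewrite mul1r.
elim: q q' => [q'|x q IH q'].
  rewrite /F1 fock_formC -/F1; case: q' => [|y q'].
    rewrite eqxx /F1; have [_ ->] := @fock_form_nil R _ _ g (leaf d) lam lam_ge0 gam1 gam1_0.
    by rewrite /gam1 mulr1 /= mfact0 /pg pweight0 expr1n !mulr1.
  rewrite cons big_nil; case: eqP => // /fsfunP/(_ y).
  by rewrite /= mset0E maddE eqxx addn1.
rewrite cons; under eq_bigr do rewrite IH.
rewrite (sum_picks (fun y N => lam * (if x == y then GW lam d x else 0) *
  (if mset_of q == N then expR lam * (mfact (mset_of q) ^+ 2 * pg (mset_of q)) else 0))).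
set N := mset_of q; set N' := mset_of q'; rewrite [mset_of (x :: q)]/= -/N.
have -> : \sum_(y <- finsupp N') (N' y)%:R * (lam * (if x == y then GW lam d x else 0) *
     (if N == msub N' y then expR lam * (mfact N ^+ 2 * pg N) else 0)) =
   (N' x)%:R * (lam * GW lam d x *
     (if N == msub N' x then expR lam * (mfact N ^+ 2 * pg N) else 0)).
  have [xN|xN] := boolP (x \in finsupp N').
    rewrite (big_fsetD1 x xN) /= eqxx big_seq big1 ?addr0// => y.
    rewrite !inE eq_sym => /andP[/negbTE -> _]; by rewrite mulr0 mul0r mulr0.
  rewrite [N' x]fsfun_dflt// mul0r big_seq big1// => y yN.
  case: eqP => [xy|_]; last by rewrite mulr0 mul0r mulr0.
  by rewrite xy yN in xN.
have [NN|NN] := eqVneq (madd N x) N'.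
  rewrite -NN maddK eqxx mfact_madd /pg.
  transitivity (expR lam * (madd N x x)%:R * mfact N ^+ 2 *
    ((lam * GW lam d x) * pweight (fun x => lam * GW lam d x) N)); first by ring.
  by rewrite -(pweight_madd (fun x => lam * GW lam d x)); ring.
have [->|Nx] := posnP (N' x); first by rewrite mul0r.
case: eqP => [NE|_]; last by rewrite !mulr0.
by rewrite NE msubK// eqxx in NN.
Qed.

Lemma fock_leaf q : fock g (leaf d) lam q [fsfun] = mfact (mset_of q) * pg (mset_of q).
Proof.
case: gP => gl _ _ _.
elim: q => [|x q IH] /=; first by rewrite finsupp0 !big_seq_fset0 mfact0 /pg pweight0 mulr1.
rewrite finsupp0 big_seq_fset0 add0r IH gl mfact_madd /pg.
transitivity (mfact (mset_of q) *
    ((lam * GW lam d x) * pweight (fun x => lam * GW lam d x) (mset_of q))); first by ring.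
by rewrite -(pweight_madd (fun x => lam * GW lam d x)); ring.
Qed.

(** The Charlier polynomial of index [b] at [N], times the Galton-Watson weight of [N]. The square
    root normalises the index, and [mfact N] removes the ordering of the list. *)
Definition fock_basis (b N : X d.+1) : R :=
  expR (- lam) * Num.sqrt (pweight (fun=> lam) b) / mfact N *
  fock g (leaf d) lam (seq_of N) b.

Let basisE gam (f : X d.+1 -> R) N N' :
  (forall b : X d.+1, f b = \prod_(x <- finsupp b) gam x ^+ b x) ->
  forall b, f b * fock_basis b N * fock_basis b N' =
  (expR (- lam) ^+ 2 / (mfact N * mfact N')) *
   fock_term g (leaf d) lam gam (seq_of N) (seq_of N') b.
Proof.
move=> fE b; rewrite /fock_term pweightM -fE /fock_basis.
have := @pweight_ge0 R (X d) (fun=> lam) b (fun=> lam_ge0).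
set r := Num.sqrt _ => /sqr_sqrtr; rewrite -/r => <-.
rewrite invfM; ring.
Qed.

Lemma spectral_step : spectral fock_basis.
Proof.
have [sG eG] := GW_sum lam0 d.
have GS (N : X d.+1) : GW lam d.+1 N = expR (- lam) * pg N.
  rewrite [LHS](@ppoisE R (X d)).
  - by rewrite ssumZ// eG mulr1.
  - by move=> x; rewrite mulr_ge0// ltW// GW_gt0.
  - exact: asummableZ.
have f1 (b : X d.+1) : (fun=> 1) b = \prod_(x <- finsupp b) gam1 x ^+ b x.
  by rewrite big1// => x _; rewrite expr1n.
(* The predecessor discards the root, leaving the sizes of the child subtrees with multiplicity. *)
have f2 (b : X d.+1) : s ^+ (tsize d.+1 b).-1 = \prod_(x <- finsupp b) gam2 x ^+ b x.
  rewrite /= expr_sum; apply: eq_bigr => x _; by rewrite /gam2 -exprM mulnC.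
have mf (N : X d.+1) : mfact N != 0 :> R by rewrite gt_eqF// mfact_gt0.
split.
- move=> N; rewrite GS /fock_basis pweight0 sqrtr1 mulr1 fock_leaf seq_ofK.
  by field.
- move=> N N'; under eq_fun do rewrite -[X in X * _]mul1r (basisE N N' f1).
  by apply: asummableZ; exact: asummable_fock.
- move=> N N'; under eq_ssum do rewrite -[X in X * _]mul1r (basisE N N' f1).
  rewrite ssumZ; last exact: asummable_fock.
  rewrite -/(fock_form g (leaf d) lam gam1 (seq_of N) (seq_of N')) -/F1.
  rewrite spectral_form1 !seq_ofK; case: eqP => [<-|_]; last by rewrite mulr0.
  rewrite GS expRN.
  by field; rewrite mf gt_eqF ?expR_gt0.
- move=> N N'; under eq_ssum do rewrite (basisE N N' f2).
  rewrite ssumZ; last exact: asummable_fock.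
  rewrite -/(fock_form g (leaf d) lam gam2 (seq_of N) (seq_of N')) -/F2.
  have [c0 sc ec] := corr_law lam0 s0 s1 d.
  rewrite spectral_form2 corrS// /bip_form !seq_ofK.
  (* Two factors exp(- lam) from the basis and exp(lam s) from the form make up the Poisson
     normalisation. *)
  rewrite (_ : - (lam * (2 - s)) = - lam + - lam + lam * s) ?expRD; last by ring.
  by field; rewrite !mf.
Qed.

End Step.

Theorem spectral_exists d : exists g : X d -> X d -> R, spectral g.
Proof.
elim: d => [|d [g gP]]; last by exists (fock_basis g); exact: spectral_step.
exists (fun _ _ => 1).
have h : forall f : X 0 -> R, asummable f /\ ssum f = f tt.
  by move=> f; apply: ssum1 => -[].
split => //.
- by move=> t t'; case: (h (fun=> 1 * 1)).
- by move=> [] []; case: (h (fun=> 1 * 1)) => _ ->; rewrite mulr1.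
- by move=> t t'; have [_ ->] := h (fun b => s ^+ (tsize 0 b).-1 * 1 * 1); rewrite !mulr1.
Qed.

End Spectral.

(** * The second moment of the likelihood ratio *)

Section Bessel.
Context {R : realType} {T : choiceType} {K : eqType}.

Lemma asummableM (f h : T -> R) : asummable (fun x => f x ^+ 2) ->
  asummable (fun x => h x ^+ 2) -> asummable (fun x => f x * h x).
Proof.
move=> sf sh; apply: asummable_le (asummableD sf sh) _ => x.
have := sqr_ge0 (`|f x| - `|h x|); rewrite normrM sqrrB !real_normK ?num_real//.
have := mulr_ge0 (normr_ge0 (f x)) (normr_ge0 (h x)); rewrite mulr2n; lra.
Qed.

Variables (v : K -> T -> R).
Hypothesis v_sum : forall k l, asummable (fun x => v k x * v l x).
Hypothesis v_on : forall k l, ssum (fun x => v k x * v l x) = (k == l)%:R.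

(** Expand the sum of (h - D)^2, where [D] is the projection of [h] on the span of the [v k] with
    [k] in [S]; orthonormality makes the quadratic term the sum of the squared coefficients. *)
Lemma bessel (h : T -> R) (S : seq K) : uniq S -> asummable (fun x => h x ^+ 2) ->
  \sum_(k <- S) (ssum (fun x => h x * v k x)) ^+ 2 <= ssum (fun x => h x ^+ 2).
Proof.
move=> uS sh; pose c k := ssum (fun x => h x * v k x).
have shv k : asummable (fun x => h x * v k x).
  by apply: asummableM => //; under eq_fun do rewrite expr2; exact: v_sum.
pose D x := \sum_(k <- S) c k * v k x.
have E x : (h x - D x) ^+ 2 = h x ^+ 2 - 2 * (\sum_(k <- S) c k * (h x * v k x))
    + \sum_(k <- S) c k * \sum_(l <- S) c l * (v k x * v l x).
  have -> : \sum_(k <- S) c k * (h x * v k x) = h x * D x.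
    by rewrite /D mulr_sumr; apply: eq_bigr => k _; ring.
  have -> : \sum_(k <- S) c k * \sum_(l <- S) c l * (v k x * v l x) = D x * D x.
    rewrite /D mulr_suml; apply: eq_bigr => k _; rewrite -mulrA; congr (_ * _).
    by rewrite mulr_sumr; apply: eq_bigr => l _; ring.
  by ring.
have s1 k : asummable (fun x => c k * (h x * v k x)) by exact: asummableZ.
have s2 k l : asummable (fun x => c l * (v k x * v l x)) by exact: asummableZ.
have s3 : asummable (fun x => \sum_(k <- S) c k * (h x * v k x)).
  by apply: asummable_sum.
have s4 k : asummable (fun x => \sum_(l <- S) c l * (v k x * v l x)).
  by apply: asummable_sum.
have s5 k : asummable (fun x => c k * \sum_(l <- S) c l * (v k x * v l x)).
  exact: asummableZ.
have s6 : asummable (fun x => \sum_(k <- S) c k * \sum_(l <- S) c l * (v k x * v l x)).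
  by apply: asummable_sum.
have s7 : asummable (fun x => 2 * \sum_(k <- S) c k * (h x * v k x)) by exact: asummableZ.
have s8 : asummable (fun x => h x ^+ 2 - 2 * (\sum_(k <- S) c k * (h x * v k x))).
  exact: asummableB.
have : 0 <= ssum (fun x => (h x - D x) ^+ 2).
  apply: ssum_ge0 => [x|]; first exact: sqr_ge0.
  by rewrite (funext E); exact: asummableD.
rewrite (funext E) ssumD// ssumB// ssumZ// !ssum_sum//.
have -> : \sum_(j <- S) ssum (fun x => c j * (h x * v j x)) = \sum_(k <- S) c k ^+ 2.
  by apply: eq_bigr => k _; rewrite ssumZ.
have -> : \sum_(j <- S) ssum (fun x => c j * \sum_(l <- S) c l * (v j x * v l x)) =
    \sum_(k <- S) c k ^+ 2.
  rewrite [LHS]big_seq [RHS]big_seq; apply: eq_bigr => k kS; rewrite ssumZ// ssum_sum//.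
  rewrite expr2; congr (_ * _).
  rewrite (bigD1_seq k)//= ssumZ// v_on eqxx mulr1 big1 ?addr0// => l lk.
  by rewrite ssumZ// v_on eq_sym (negbTE lk) mulr0.
by rewrite -/c; lra.
Qed.

End Bessel.

(* Hilbert-Schmidt norm of V diag(a) V^T for a coisometry V: Bessel's inequality is
   applied to a * v k, then to the indicator of a point to get
   \sum_k (v k x)^2 <= 1. *)
Lemma bessel_mul {R : realType} {T K : choiceType} (v : K -> T -> R) (a : T -> R)
  (S : seq K) : uniq S ->
  (forall k l, asummable (fun x => v k x * v l x)) ->
  (forall k l, ssum (fun x => v k x * v l x) = (k == l)%:R) ->
  (forall x, `|a x| <= 1) -> asummable (fun x => a x ^+ 2) ->
  \sum_(k <- S) \sum_(l <- S) (ssum (fun x => a x * v k x * v l x)) ^+ 2 <=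
  ssum (fun x => a x ^+ 2).
Proof.
move=> uS v_sum v_on a1 sa.
have sv k : asummable (fun x => v k x ^+ 2).
  by under eq_fun do rewrite expr2; exact: v_sum.
have sav k : asummable (fun x => (a x * v k x) ^+ 2).
  apply: asummable_le (sv k) _ => x.
  rewrite ger0_norm ?sqr_ge0// exprMn ler_piMl ?sqr_ge0//.
  by rewrite -[a x ^+ 2]real_normK ?num_real// exprn_ile1.
apply: (@le_trans _ _ (\sum_(k <- S) ssum (fun x => (a x * v k x) ^+ 2))).
  by apply: ler_sum => k _; exact: bessel.
rewrite -ssum_sum//; apply: le_ssum => //; first exact: asummable_sum.
move=> x; under eq_bigr do rewrite exprMn.
rewrite -mulr_sumr ler_piMr ?sqr_ge0//.
pose h y : R := (y == x)%:R.
have hz f : (forall y, y != x -> h y * f y = 0) by move=> y /negbTE yx; rewrite /h yx mul0r.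
have [sh eh] : asummable (fun y => h y ^+ 2) /\ ssum (fun y => h y ^+ 2) = 1.
  have := @ssum1 R T x (fun y => h y ^+ 2); rewrite {4}/h eqxx expr1n; apply.
  by move=> y /negbTE yx; rewrite /h yx expr0n.
have := @bessel R T K v v_sum v_on h S uS sh; rewrite eh; congr (_ <= _).
apply: eq_bigr => k _; have [_ ->] := ssum1 (hz (v k)).
by rewrite /h eqxx mul1r.
Qed.

(** * Chi-square bound for the correlated law against the null law *)

Section ChiSquare.
Context {R : realType}.
Variables (lam s : R).
Hypotheses (lam0 : 0 < lam) (s0 : 0 <= s) (s1 : s <= 1).

(** Dividing by the square roots of the weights turns completeness into orthonormality of the rows
    [v t], and P / sqrt(pi pi) into an entry of v diag(a) v^T. *)
Lemma chi_square d : asummable (fun b : X d => (s ^+ 2) ^+ (tsize d b).-1) ->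
  (esumr (fun q => corr lam s d q ^+ 2 / null lam d q)%R <=
    (ssum (fun b : X d => (s ^+ 2) ^+ (tsize d b).-1)%R)%:E)%E.
Proof.
have [g [_ gs go gc]] := spectral_exists lam0 s0 s1 d.
pose r t := Num.sqrt (GW lam d t).
have r2 t : r t ^+ 2 = GW lam d t by rewrite sqr_sqrtr// ltW// GW_gt0.
have r0 t : 0 < r t by rewrite sqrtr_gt0 GW_gt0.
have rn t : r t != 0 by rewrite gt_eqF.
pose v t b := g b t / r t.
pose a b := s ^+ (tsize d b).-1.
have a2 b : (s ^+ 2) ^+ (tsize d b).-1 = a b ^+ 2 by rewrite /a exprAC.
have a01 b : 0 <= a b <= 1 by rewrite exprn_ge0//= exprn_ile1.
rewrite (funext a2) => sa.
have vE t t' (f : X d -> R) b : f b * v t b * v t' b = (r t * r t')^-1 * (f b * g b t * g b t').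
  by rewrite /v invfM; ring.
have vE1 t t' b : v t b * v t' b = (r t * r t')^-1 * (g b t * g b t').
  by rewrite /v invfM; ring.
have v_sum t t' : asummable (fun b => v t b * v t' b).
  by under eq_fun do rewrite vE1; exact: asummableZ.
have v_on t t' : ssum (fun b => v t b * v t' b) = (t == t')%:R.
  under eq_ssum do rewrite vE1; rewrite ssumZ// go; case: eqP => [->|_]; last by rewrite mulr0.
  by rewrite -expr2 r2 mulVf// gt_eqF// GW_gt0.
have sag t t' : asummable (fun b => a b * g b t * g b t').
  apply: asummable_le (asummable_abs (gs t t')) _ => b.
  have /andP[a0 a1] := a01 b.
  by rewrite -mulrA normrM ler_piMl// ger0_norm.
have corrE t t' : ssum (fun b => a b * v t b * v t' b) ^+ 2 =
    corr lam s d (t, t') ^+ 2 / null lam d (t, t').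
  under eq_ssum do rewrite vE; rewrite ssumZ// gc exprMn exprVn exprMn !r2 mulrC.
  by [].
have f0 q : 0 <= corr lam s d q ^+ 2 / null lam d q.
  by rewrite divr_ge0 ?sqr_ge0// /null mulr_ge0// ltW// GW_gt0.
apply: esumr_fin_le => F; rewrite lee_fin.
(* Nonnegativity allows the finite set of pairs to be enlarged to a square grid, the shape that
   [bessel_mul] needs. *)
pose S : {fset X d} := ([fset q.1 | q in F] `|` [fset q.2 | q in F])%fset.
pose L := [seq (t, t') | t <- enum_fset S, t' <- enum_fset S].
have uL : uniq L.
  apply: allpairs_uniq; try exact: fset_uniq.
  by move=> [? ?] [? ?] _ _ /=.
have FL : {subset enum_fset F <= L}.
  move=> [t t'] qF; apply/allpairsP; exists (t, t'); split => //=.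
    by rewrite inE; apply/orP; left; apply/imfsetP; exists (t, t').
  by rewrite inE; apply/orP; right; apply/imfsetP; exists (t, t').
have -> : \sum_(q <- F) corr lam s d q ^+ 2 / null lam d q =
   \sum_(q <- L | q \in F) corr lam s d q ^+ 2 / null lam d q.
  rewrite -[RHS]big_filter; apply: perm_big; apply: uniq_perm; rewrite ?fset_uniq ?filter_uniq//.
  by move=> q; rewrite mem_filter; case: (boolP (q \in F)) => //= /FL ->.
apply: (@le_trans _ _ (\sum_(q <- L) corr lam s d q ^+ 2 / null lam d q)).
  by rewrite big_mkcond; apply: ler_sum => q _; case: ifP => _.
rewrite big_allpairs_dep.
have -> : \sum_(t <- S) \sum_(t' <- S) corr lam s d (t, t') ^+ 2 / null lam d (t, t') =
   \sum_(t <- S) \sum_(t' <- S) ssum (fun b => a b * v t b * v t' b) ^+ 2.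
  by apply: eq_bigr => t _; apply: eq_bigr => t' _; rewrite corrE.
apply: bessel_mul => //.
by move=> b; have /andP[a0 a1] := a01 b; rewrite ger0_norm.
Qed.

End ChiSquare.

(** * Counting trees *)

Section MsetMap.
Context {I J : choiceType}.

Lemma mset_ofE (s : seq I) x : mset_of s x = count_mem x s.
Proof.
by elim: s => [|y s IH] /=; rewrite ?mset0E// maddE IH addnC eq_sym.
Qed.

Lemma mset_of_eq (s s' : seq I) : mset_of s = mset_of s' <-> perm_eq s s'.
Proof.
split=> [h|h].
  by apply/allP => x _; rewrite /= -!mset_ofE h.
by apply/fsfunP => x; rewrite !mset_ofE (permP h).
Qed.

Lemma sum_mset_of (F : I -> nat) (s : seq I) :
  (\sum_(x <- finsupp (mset_of s)) mset_of s x * F x = \sum_(x <- s) F x)%N.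
Proof.
have -> : (\sum_(x <- finsupp (mset_of s)) mset_of s x * F x =
   \sum_(x <- undup s) mset_of s x * F x)%N.
  apply: perm_big; apply: uniq_perm; rewrite ?fset_uniq ?undup_uniq// => x.
  by rewrite mem_undup mem_finsupp_gt0 mset_ofE -has_count has_pred1.
under eq_bigr do rewrite mset_ofE.
rewrite -[RHS]big_undup_iterop_count; apply: eq_bigr => x _.
by rewrite Monoid.iteropE iter_addn addn0 mulnC.
Qed.

Definition mset_map (f : I -> J) (N : mset I) : mset J := mset_of (map f (seq_of N)).

End MsetMap.

Lemma tsizeS d (s : seq (X d)) : tsize d.+1 (mset_of s) = (\sum_(x <- s) tsize d x).+1.
Proof. by rewrite /= sum_mset_of add1n. Qed.

Lemma tsizeE d (t : X d.+1) : tsize d.+1 t = (\sum_(x <- seq_of t) tsize d x).+1.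
Proof. by rewrite -tsizeS seq_ofK. Qed.

Lemma tsize_eq1 d (t : X d) : tsize d t = 1%N -> t = leaf d.
Proof.
case: d t => [[]//|d] t; rewrite tsizeE -{2}(seq_ofK t).
case: (seq_of t) => [//|x q]; rewrite big_cons.
by have := tsize_gt0 x; lia.
Qed.

(* The tree [t : X d] in the encoding of depth e, cut below depth e; nothing is cut
   when [t] has at most e.+1 nodes. *)
Fixpoint retype (d e : nat) : X d -> X e :=
  match d return X d -> X e with
  | 0 => fun _ => leaf e
  | d'.+1 => match e return X d'.+1 -> X e with
             | 0 => fun _ => leaf 0
             | e'.+1 => @mset_map (X d') (X e') (@retype d' e')
             end
  end.

(** A child subtree omits at least the root, so the size bound drops by one with each level and
    nothing is ever cut. *)
Lemma retypeK d e (t : X d) : (tsize d t <= e.+1)%N ->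
  retype d (retype e t) = t /\ tsize e (retype e t) = tsize d t.
Proof.
elim: d e t => [e []|d IH [|e] t] h.
- split; last by rewrite [retype _ _]/= tsize_leaf.
  by case: e {h} => //.
- have t1 : tsize d.+1 t = 1%N by have := tsize_gt0 t; lia.
  by rewrite t1 (tsize_eq1 t1).
have hx x : x \in seq_of t -> (tsize d x <= e.+1)%N.
  move=> xt; move: h; rewrite tsizeE (big_rem x xt) /=; lia.
split; last first.
  rewrite [retype _ _]/= tsizeE tsizeE; congr S.
  have /mset_of_eq p := seq_ofK (mset_of (map (retype e) (seq_of t))).
  rewrite (perm_big _ p) big_map; apply: eq_big_seq => x xt.
  by case: (IH e x (hx x xt)).
rewrite [retype _ _]/= -[RHS]seq_ofK [LHS]/= /mset_map.
have /mset_of_eq p := seq_ofK (mset_of (map (retype e) (seq_of t))).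
apply/mset_of_eq; apply: (perm_trans (perm_map _ p)).
rewrite -map_comp (_ : map _ _ = seq_of t) //.
rewrite -[RHS]map_id; apply/eq_in_map => x xt /=.
by case: (IH e x (hx x xt)).
Qed.

Section Counting.
Context {R : realType}.

(** A tree with n nodes has depth below n, so re-encoding it at depth [n.-1] keeps its size and is
    injective. *)
Lemma count_le_Acount d n (F : {fset X d}) :
  ((\sum_(b <- F | tsize d b == n) 1)%:E <= @Acount R n)%E.
Proof.
pose Fn := [fset b in F | tsize d b == n]%fset.
have FnP b : b \in Fn -> tsize d b = n by rewrite !inE => /andP[_ /eqP].
have sz b : b \in Fn -> (tsize d b <= n.-1.+1)%N by move=> /FnP ->; case: (n).
pose G := [fset retype n.-1 b | b in Fn]%fset.
have cG : #|` G| = #|` Fn|.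
  apply: card_in_imfset => b b' bF bF' e.
  by rewrite -(retypeK (sz b bF)).1 e (retypeK (sz b' bF')).1.
have -> : \sum_(b <- F | tsize d b == n) 1 = \sum_(b <- G) 1 :> R.
  rewrite -big_filter.
  have -> : \sum_(b <- [seq b <- F | tsize d b == n]) 1 = \sum_(b <- Fn) 1 :> R.
    apply: perm_big; apply: uniq_perm; rewrite ?filter_uniq ?fset_uniq// => b.
    by rewrite mem_filter !inE andbC.
  by rewrite !big_const_seq !count_predT !iter_addr !addr0 cG.
apply: esum_ge; exists [set` G].
  split => // t /= /imfsetP[b /= bF ->].
  by rewrite (retypeK (sz b bF)).2 FnP.
by rewrite fsbig_finite//= set_fsetK sumEFin.
Qed.

Lemma treegf_le_Acount d (x : R) : 0 <= x ->
  (esumr (fun b : X d => x ^+ (tsize d b).-1)%R <=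
   \esum_(n in [set n : nat | (0 < n)%N]) (Acount n * (x ^+ n.-1)%:E))%E.
Proof.
move=> x0; apply: esumr_fin_le => F.
pose N := (\max_(b <- F) tsize d b).+1.
have bN b : b \in F -> (tsize d b < N)%N.
  by move=> bF; rewrite ltnS; apply: (@leq_bigmax_seq _ _ xpredT).
have -> : \sum_(b <- F) x ^+ (tsize d b).-1 =
    \sum_(1 <= n < N) (\sum_(b <- F | tsize d b == n) 1) * x ^+ n.-1.
  transitivity (\sum_(b <- F) \sum_(1 <= n < N) (if tsize d b == n then x ^+ n.-1 else 0)).
    apply: eq_big_seq => b /bN bF; rewrite (bigD1_seq (tsize d b)) ?iota_uniq//=; last first.
      by rewrite mem_index_iota bF tsize_gt0.
    rewrite eqxx big1 ?addr0// => n; rewrite eq_sym.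
    by case: eqP => // -> /=.
  rewrite exchange_big /=; apply: eq_bigr => n _; rewrite mulr_suml [RHS]big_mkcond.
  by apply: eq_bigr => b _; rewrite mul1r.
rewrite -sumEFin; apply: esum_ge.
exists [set` [fset n in index_iota 1 N]%fset].
  by split => // n /=; rewrite !inE mem_index_iota => /andP[].
rewrite fsbig_finite//= set_fsetK.
have -> : \sum_(i <- [fset n in index_iota 1 N]%fset) (@Acount R i * (x ^+ i.-1)%:E)%E
   = (\sum_(1 <= i < N) Acount i * (x ^+ i.-1)%:E)%E.
  apply: perm_big; apply: uniq_perm; rewrite ?fset_uniq ?iota_uniq// => n.
  by rewrite !inE.
apply: lee_sum => n _; rewrite EFinM lee_wpmul2r//; last exact: count_le_Acount.
by rewrite lee_fin exprn_ge0.
Qed.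

(** * Generating functions of trees up to Otter's constant *)

Definition fork d (p : X d * X d) : X d.+1 := mset_of [:: p.1; p.2].

(** Sorting by [pickle] selects one order of each unordered pair, and two sorted lists with the same
    entries coincide. *)
Lemma fork_inj d (p q : X d * X d) : (choice.pickle p.1 <= choice.pickle p.2)%N ->
  (choice.pickle q.1 <= choice.pickle q.2)%N -> fork p = fork q -> p = q.
Proof.
case: p q => [a b] [c e] /= h1 h2 /mset_of_eq /(perm_map choice.pickle) /= h.
have : [:: choice.pickle a; choice.pickle b] = [:: choice.pickle c; choice.pickle e].
  apply: (sorted_eq leq_trans anti_leq) => //=; by rewrite andbT.
by case=> /(pcan_inj choice.pickleK) -> /(pcan_inj choice.pickleK) ->.
Qed.

Lemma forkC d (a b : X d) : fork (a, b) = fork (b, a).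
Proof. by apply/mset_of_eq; rewrite (perm_catC [:: a] [:: b]). Qed.

Lemma fork_inj_gt d (p q : X d * X d) : (choice.pickle p.2 < choice.pickle p.1)%N ->
  (choice.pickle q.2 < choice.pickle q.1)%N -> fork p = fork q -> p = q.
Proof.
case: p q => [a b] [c e] /= h1 h2; rewrite (forkC a) (forkC c).
by move/fork_inj => /= /(_ (ltnW h1) (ltnW h2)) [-> ->].
Qed.

(* [fork] is at most two-to-one: it is injective on the pairs sorted by [pickle], and
   on the pairs sorted the other way. *)
Lemma treegf_fork d (x : R) : 0 <= x ->
  asummable (fun b : X d => x ^+ (tsize d b).-1) ->
  asummable (fun b : X d.+1 => x ^+ (tsize d.+1 b).-1) ->
  x ^+ 2 * ssum (fun b : X d => x ^+ (tsize d b).-1) ^+ 2 <=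
  2 * ssum (fun b : X d.+1 => x ^+ (tsize d.+1 b).-1).
Proof.
move=> x0 s1 s2.
pose h (e : nat) (b : X e) := x ^+ (tsize e b).-1.
have h0 e b : 0 <= h e b by exact: exprn_ge0.
(* The fork has |p.1| + |p.2| + 1 nodes; with one subtracted in each exponent this leaves the factor
   [x ^+ 2]. *)
have hf (p : X d * X d) : h d.+1 (fork p) = x ^+ 2 * (h d p.1 * h d p.2).
  rewrite /h tsizeS !big_cons big_nil addn0 -!exprD; congr (_ ^+ _).
  by have := tsize_gt0 p.1; have := tsize_gt0 p.2; rewrite /=; lia.
have [sp ep] := ssum_prod s1 s1.
rewrite [ssum _ ^+ 2]expr2 -ep -ssumZ//.
have half (F : {fset X d * X d}) (P : pred (X d * X d)) :
    (forall p q, P p -> P q -> fork p = fork q -> p = q) ->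
    \sum_(p <- F | P p) h d.+1 (fork p) <= ssum (h d.+1).
  move=> Pinj; rewrite big_fset_condE /=.
  pose G := [fset fork p | p in [fset p in F | P p]%fset]%fset.
  have -> : \sum_(p <- [fset p in F | P p]%fset) h d.+1 (fork p) = \sum_(b <- G) h d.+1 b.
    rewrite [RHS]big_imfset //= => p q; rewrite !inE => /andP[_ Pp] /andP[_ Pq].
    exact: Pinj.
  by rewrite -lee_fin ge0_ssum//; exact: fset_esumr_le.
rewrite -lee_fin ge0_ssum; first last.
- exact: asummableZ.
- by move=> p; rewrite !mulr_ge0// ?exprn_ge0.
apply: esumr_fin_le => F; rewrite lee_fin.
under eq_bigr do rewrite -/(h d _) -/(h d _) -hf.
rewrite (bigID (fun p => choice.pickle p.1 <= choice.pickle p.2)%N) /= mulr2n mulrDl mul1r.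
apply: lerD; apply: half => p q; first exact: fork_inj.
by rewrite -!ltnNge; exact: fork_inj_gt.
Qed.

(** The supremum [S] over all depths satisfies x^2 S^2 <= 2 S. The constant [C] ensures that [S] is
    finite but does not enter the final bound, which is therefore uniform up to the critical
    point. *)
Lemma treegf_bound (x C : R) : 0 < x ->
  (forall d, asummable (fun b : X d => x ^+ (tsize d b).-1)) ->
  (forall d, ssum (fun b : X d => x ^+ (tsize d b).-1) <= C) ->
  forall d, x ^+ 2 * ssum (fun b : X d => x ^+ (tsize d b).-1) <= 2.
Proof.
move=> x0 sm sC; pose M d := ssum (fun b : X d => x ^+ (tsize d b).-1).
have M0 d : 0 <= M d.
  by apply: ssum_ge0 => // b; rewrite exprn_ge0// ltW.
pose S := sup (range M).
have hS : has_sup (range M).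
  by split; [exists (M 0), 0%N | exists C => _ [d _ <-]; exact: sC].
have MS d : M d <= S by apply: ub_le_sup; [case: hS | exists d].
have S0 : 0 <= S by apply: le_trans (M0 0) (MS 0).
have x2 : 0 < x ^+ 2 by rewrite exprn_gt0.
have MK d : M d <= Num.sqrt (2 * S / x ^+ 2).
  rewrite -(ger0_norm (M0 d)) -sqrtr_sqr; apply: ler_wsqrtr.
  rewrite ler_pdivlMr// mulrC; apply: (le_trans (treegf_fork (ltW x0) (sm d) (sm d.+1))).
  by rewrite ler_pM2l//; exact: (MS d.+1).
have SK : S <= Num.sqrt (2 * S / x ^+ 2).
  by apply: ge_sup => [|_ [d _ <-]]; [case: hS | exact: MK].
have S2 : S * (x ^+ 2 * S) <= S * 2.
  have nn : 0 <= 2 * S / x ^+ 2 by rewrite divr_ge0 ?mulr_ge0// ltW.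
  have : S ^+ 2 <= Num.sqrt (2 * S / x ^+ 2) ^+ 2 by rewrite ler_sqr ?nnegrE ?sqrtr_ge0.
  rewrite (sqr_sqrtr nn) ler_pdivlMr//.
  by rewrite expr2; lra.
move=> d; apply: (@le_trans _ _ (x ^+ 2 * S)); first by rewrite ler_pM2l//; exact: MS.
move: S0; rewrite le_eqVlt => /orP[/eqP <-|S0]; first by rewrite mulr0.
by rewrite -(ler_pM2l S0).
Qed.

Lemma bernoulli (e : R) k : 0 <= e <= 1 -> 1 - k%:R * e <= (1 - e) ^+ k.
Proof.
move=> /andP[e0 e1]; elim: k => [|k IH]; first by rewrite mul0r subr0 expr0.
rewrite exprS; apply: (@le_trans _ _ ((1 - e) * (1 - k%:R * e))).
  have : 0 <= k%:R * e * e by rewrite !mulr_ge0.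
  by rewrite -natr1; lra.
by rewrite ler_wpM2l// subr_ge0.
Qed.

Lemma scale_limit (P : R) (k : nat) (c : R) : 0 <= c ->
  (forall e, 0 < e < 1 -> (1 - e) ^+ k * P <= c) -> P <= c.
Proof.
move=> c0 h; rewrite leNgt; apply/negP => cP.
have P0 : 0 < P by apply: le_lt_trans cP.
pose e := (P - c) / (P * (k.+2)%:R).
have k0 : (0 : R) < (k.+2)%:R by rewrite ltr0n.
have e0 : 0 < e by rewrite divr_gt0 ?mulr_gt0 ?subr_gt0.
have Pe : P * (k.+2)%:R * e = P - c.
  by rewrite /e mulrC divfK// gt_eqF// mulr_gt0.
have k2 : (k.+2)%:R = k%:R + 2 :> R by rewrite -addn2 natrD.
have kr : 0 <= k%:R :> R by [].
have ePe : 0 < P * e by rewrite mulr_gt0.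
have kPe : 0 <= k%:R * (P * e) by rewrite mulr_ge0// ltW.
have Pe' : k%:R * (P * e) + 2 * (P * e) = P - c by rewrite -Pe k2; ring.
have e1 : e < 1.
  rewrite -(ltr_pM2l P0) mulr1; lra.
have := h e; rewrite e0 e1 => /(_ isT) hh.
have := @bernoulli e k; rewrite (ltW e0) (ltW e1) => /(_ isT) b.
have : (1 - k%:R * e) * P <= c.
  by apply: le_trans hh; rewrite ler_pM2r.
by rewrite mulrBl mul1r; lra.
Qed.

(** At [x < u] the series converges by definition of the radius, and the bound by 2 does not depend
    on [x]. In finite sums [x] may tend to [u], which covers [u] equal to the constant itself. *)
Theorem treegf_critical (u : R) : 0 < u -> u <= otter ->
  forall d, asummable (fun b : X d => u ^+ (tsize d b).-1) /\
    u ^+ 2 * ssum (fun b : X d => u ^+ (tsize d b).-1) <= 2.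
Proof.
move=> u0 uo.
(* An infinite radius would make [otter] zero by the convention on [fine], against [0 < u]. *)
have finr : @otter_radius R \is a fin_num.
  have : 0 < @otter R by exact: lt_le_trans uo.
  by rewrite /otter; case: (@otter_radius R) => //=; rewrite ltxx.
have sub (x : R) : 0 < x -> x < u -> forall d,
    asummable (fun b : X d => x ^+ (tsize d b).-1) /\
    x ^+ 2 * ssum (fun b : X d => x ^+ (tsize d b).-1) <= 2.
  move=> x0 xu.
  have : (x%:E < @otter_radius R)%E.
    by rewrite -(fineK finr) lte_fin; apply: lt_le_trans xu uo.
  move=> /ereal_sup_gt[_ [y [y0 yf] <-]]; rewrite lte_fin => xy.
  set A := \esum_(n in _) _ in yf.
  have A0 : (0 <= A)%E.
    apply: esum_ge0 => n _; rewrite mule_ge0//; last by rewrite lee_fin exprn_ge0.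
    by apply: esum_ge0.
  have le_d d : (esumr (fun b : X d => x ^+ (tsize d b).-1)%R <= A)%E.
    apply: le_trans (treegf_le_Acount d y0); apply: le_esumr => b.
    by apply: lerXn2r; rewrite ?nnegrE//; exact: ltW.
  have p0 d (b : X d) : 0 <= x ^+ (tsize d b).-1 by rewrite exprn_ge0// ltW.
  have sm d : asummable (fun b : X d => x ^+ (tsize d b).-1).
    apply: le_lt_trans yf; apply: le_trans (le_d d); apply: le_esumr => b.
    by rewrite ger0_norm.
  have Cb d : ssum (fun b : X d => x ^+ (tsize d b).-1) <= fine A.
    by rewrite -lee_fin ge0_ssum// fineK// ge0_fin_numE.
  move=> d; split; [exact: sm | exact: (treegf_bound x0 sm Cb)].
move=> d.
have u2 : 0 < u ^+ 2 by rewrite exprn_gt0.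
have fin (F : {fset X d}) : u ^+ 2 * (\sum_(b <- F) u ^+ (tsize d b).-1) <= 2.
  pose k := (\max_(b <- F) tsize d b)%N.
  (* Exponents in the sum are at most [k], and the prefactor [u ^+ 2] adds two more powers of
     [1 - e]. *)
  apply: (@scale_limit _ (k + 2)) => // e /andP[e0 e1].
  have f0 : 0 < 1 - e by rewrite subr_gt0.
  have xu : (1 - e) * u < u by rewrite gtr_pMl// gtrBl.
  have [sx bx] := sub _ (mulr_gt0 f0 u0) xu d.
  apply: le_trans bx.
  rewrite exprD exprMn [(1 - e) ^+ k * _]mulrC mulrACA.
  rewrite ler_pM2l ?mulr_gt0 ?exprn_gt0//.
  apply: (@le_trans _ _ (\sum_(b <- F) ((1 - e) * u) ^+ (tsize d b).-1)).
    rewrite mulr_sumr [leLHS]big_seq [leRHS]big_seq; apply: ler_sum => b bF.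
    rewrite exprMn ler_pM2r ?exprn_gt0//; apply: ler_wiXn2l; rewrite ?ltW//.
      by rewrite gtrBl.
    by apply: (leq_trans (leq_pred _)); apply: (@leq_bigmax_seq _ _ xpredT).
  rewrite -lee_fin ge0_ssum//; last by move=> b; rewrite exprn_ge0// mulr_ge0 ?ltW.
  by apply: fset_esumr_le => b; rewrite exprn_ge0// mulr_ge0 ?ltW.
have p0 (b : X d) : 0 <= u ^+ (tsize d b).-1 by rewrite exprn_ge0// ltW.
have fin' (F : {fset X d}) : \sum_(b <- F) u ^+ (tsize d b).-1 <= 2 / u ^+ 2.
  by rewrite ler_pdivlMr// mulrC.
have sm : asummable (fun b : X d => u ^+ (tsize d b).-1).
  apply: (@asummable_fin _ _ _ (2 / u ^+ 2)) => F.
  by apply: le_trans (fin' F); apply: ler_sum => b _; rewrite ger0_norm.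
split => //; rewrite mulrC -ler_pdivlMr// -lee_fin ge0_ssum//.
by apply: esumr_fin_le => F; rewrite lee_fin.
Qed.

Theorem treegf_uniform (u : R) : 0 <= u -> u <= otter ->
  exists C : R, forall d, asummable (fun b : X d => u ^+ (tsize d b).-1) /\
    ssum (fun b : X d => u ^+ (tsize d b).-1) <= C.
Proof.
move=> u0 uo; move: u0; rewrite le_eqVlt => /orP[/eqP <-|u0].
  (* At zero only the leaf contributes, since 0^0 = 1. *)
  exists 1 => d.
  have h (b : X d) : b != leaf d -> (0 : R) ^+ (tsize d b).-1 = 0.
    move=> bl; rewrite expr0n; case: eqP => // t1.
    case/eqP: bl; apply: tsize_eq1; have := tsize_gt0 b; lia.
  by have [s ->] := ssum1 h; split => //; rewrite tsize_leaf expr0.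
exists (2 / u ^+ 2) => d; have [s b] := treegf_critical u0 uo d.
by split => //; rewrite ler_pdivlMr ?exprn_gt0// mulrC.
Qed.

End Counting.

(** * Divergence and tests *)

Section Tests.
Context {R : realType} {T : countType}.
Variables (p q : T -> R).
Hypotheses (p0 : forall x, 0 <= p x) (q0 : forall x, 0 < q x).

(** Uses ln y <= y - 1 <= y at y = p / q. *)
Lemma kl_term_le x : (maxe (kl_term p q x) 0 <= (p x ^+ 2 / q x)%:E)%E.
Proof.
have r0 : 0 <= p x ^+ 2 / q x by rewrite divr_ge0 ?sqr_ge0// ltW.
rewrite /kl_term ge_max lee_fin r0 andbT.
case: eqP => [_|/eqP px]; first by rewrite lee_fin.
rewrite gt_eqF// lee_fin expr2 -mulrA ler_wpM2l//.
have pq : 0 < p x / q x by rewrite divr_gt0// lt_neqAle eq_sym px p0.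
have := le_ln1Dx (_ : -1 < p x / q x - 1).
rewrite [1 + _]addrC subrK => h; apply: (le_trans (h _)); last by rewrite gerBl.
by rewrite ltrBrDl subrr.
Qed.

Lemma KL_le : (KL p q <= esumr (fun x => p x ^+ 2 / q x)%R)%E.
Proof.
rewrite /KL; apply: (@le_trans _ _ (\esum_(x in [set: T]) maxe (kl_term p q x) 0)).
  by rewrite geeDl// oppe_le0; apply: esum_ge0 => x _; rewrite le_max lexx orbT.
by apply: le_esum => x _; exact: kl_term_le.
Qed.

(** The parameter [K] stays free: a large [K] makes the last term small, and then events rare under
    [q] are rare under [p]. *)
Lemma prob_le (C K : R) (A : set T) : asummable p -> asummable q ->
  (esumr (fun x => p x ^+ 2 / q x)%R <= C%:E)%E -> 0 < K ->
  prob p A <= K * prob q A + C / K.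
Proof.
move=> sp sq chi K0.
pose i x : R := (x \in A)%:R.
have pE (f : T -> R) : (forall x, 0 <= f x) -> asummable f ->
    asummable (fun x => f x * i x) /\ prob f A = ssum (fun x => f x * i x).
  move=> f0 sf.
  have si : asummable (fun x => f x * i x).
    apply: asummable_le sf _ => x; rewrite ger0_norm ?mulr_ge0 ?ler0n//.
    by rewrite ler_piMr// /i lern1 leq_b1.
  split => //; rewrite /prob.
  have -> : \esum_(x in A) (f x)%:E = esumr (fun x => f x * i x).
    rewrite esum_mkcond; apply: eq_esum => x _; rewrite /i.
    by case: (x \in A); rewrite ?mulr1 ?mulr0.
  by rewrite -ge0_ssum// => x; rewrite mulr_ge0 ?ler0n.
have q0' x : 0 <= q x by exact: ltW.
have [s1 ->] := pE p p0 sp; have [s2 ->] := pE q q0' sq.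
have c0 x : 0 <= p x ^+ 2 / q x by rewrite divr_ge0 ?sqr_ge0.
have sc : asummable (fun x => p x ^+ 2 / q x).
  apply: (@le_lt_trans _ _ C%:E); last exact: ltry.
  apply: le_trans chi; apply: le_esumr => x; by rewrite ger0_norm.
have : ssum (fun x => p x ^+ 2 / q x) <= C by rewrite -lee_fin ge0_ssum.
rewrite -(ler_pM2l (_ : 0 < K^-1)) ?invr_gt0// => h.
rewrite [C / K]mulrC; apply: le_trans (lerD (lexx _) h).
have sK1 := asummableZ K s2; have sK2 := asummableZ K^-1 sc.
rewrite -!ssumZ// -ssumD//; apply: le_ssum => //; first exact: asummableD.
move=> x; rewrite /i; case: (x \in A); last by rewrite !mulr0 add0r mulr_ge0// invr_ge0 ltW.
rewrite !mulr1.
have qx := q0 x; have qn : q x != 0 by rewrite gt_eqF.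
have Kn : K != 0 by rewrite gt_eqF.
(* AM-GM in the form p <= K q + p^2 / (K q) *)
have -> : K * q x + K^-1 * (p x ^+ 2 / q x) =
    p x + ((p x - K * q x) ^+ 2 + p x * (K * q x)) / (K * q x).
  by field; rewrite qn Kn.
rewrite lerDl divr_ge0//; last by rewrite ltW// mulr_gt0.
by rewrite addr_ge0 ?sqr_ge0// !mulr_ge0// ltW.
Qed.

End Tests.

Lemma otter_ge0 {R : realType} : 0 <= @otter R.
Proof.
rewrite /otter /otter_radius; set S := [set _ | _ in _].
(* An empty set would have supremum -oo, which [fine] sends to 0. *)
have [->|/set0P[y Sy]] := eqVneq S set0; first by rewrite ereal_sup0.
apply: fine_ge0; apply: (@le_trans _ _ y); last exact: ereal_sup_ubound.
by case: Sy => x [x0 _] <-; rewrite lee_fin.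
Qed.

Local Open Scope ereal_scope.

Theorem theorem2 (R : realType) (s : R)
  (hs0 : (0 <= s)%R) (hs1 : (s <= 1)%R) (hsa : (s <= Num.sqrt (@otter R))%R) :
  forall lam : R, (0 < lam)%R ->
    limn_esup (fun d => KL (corr lam s d) (null lam d)) < +oo /\
    ~ (exists T : forall d : nat, X d * X d -> bool, one_sided_test lam s T).
Proof.
move=> lam lam0.
have s2o : (s ^+ 2 <= @otter R)%R.
  by rewrite -(sqr_sqrtr otter_ge0) ler_sqr// ?nnegrE ?sqrtr_ge0.
have [C CP] := treegf_uniform (sqr_ge0 s) s2o.
have chi d : esumr (fun q => corr lam s d q ^+ 2 / null lam d q)%R <= C%:E.
  have [sa sC] := CP d.
  by apply: (le_trans (chi_square lam0 hs0 hs1 sa)); rewrite lee_fin.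
have c0 d : forall q, (0 <= corr lam s d q)%R by case: (corr_law lam0 hs0 hs1 d).
have sc d : asummable (corr lam s d) by case: (corr_law lam0 hs0 hs1 d).
have n0 d q : (0 < null lam d q)%R by rewrite /null mulr_gt0 ?GW_gt0.
have sn d : asummable (null lam d : X d * X d -> R).
  have [sG _] := GW_sum lam0 d.
  by case: (ssum_prod sG sG).
split.
  apply: (@le_lt_trans _ _ C%:E); last exact: ltry.
  (* The limit superior is an infimum of suprema over sets of the filter, and the whole index set is
     one of them. *)
  apply: (@le_trans _ _ (ereal_sup (range (fun d => KL (corr lam s d) (null lam d))))).
    by apply: ereal_inf_lbound; exists setT => //; exact: filterT.
  by apply: ge_ereal_sup => _ [d _ <-]; apply: le_trans (chi d); exact: KL_le.
case=> T [tn tp].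
pose pc d := prob (corr lam s d) [set x | T d x].
have pc0 d : (0 <= pc d)%R.
  by apply: fine_ge0; apply: esum_ge0 => x _; rewrite lee_fin.
have cv : pc @ \oo --> (0%R : R).
  apply/cvgrPdist_le => e e0.
  (* [D] is positive and exceeds [C], and [K] is chosen so that [D / K = e / 2]; the vanishing error
     under the null law brings the other term below [e / 2]. *)
  pose D := (`|C| + 1)%R; have D0 : (0 < D)%R by rewrite ltr_wpDl.
  pose K := (2 * D / e)%R; have K0 : (0 < K)%R by rewrite divr_gt0// mulr_gt0.
  have eK : (0 < e / 2 / K)%R by rewrite divr_gt0// divr_gt0.
  have /cvgrPdist_le/(_ _ eK) := tn.
  apply: filterS => d; rewrite !sub0r !normrN => h.
  rewrite (ger0_norm (pc0 d)).
  have h1 := prob_le (@c0 d) (@n0 d) [set x | T d x] (sc d) (sn d) (chi d) K0.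
  apply: (le_trans h1).
  have h2 : (K * prob (null lam d) [set x | T d x] <= e / 2)%R.
    by rewrite mulrC -ler_pdivlMr//; apply: le_trans (ler_norm _) h.
  have h3 : (C / K <= e / 2)%R.
    rewrite ler_pdivrMr// /K.
    have -> : (e / 2 * (2 * D / e) = D)%R by field; rewrite gt_eqF.
    by rewrite /D; have := ler_norm C; lra.
  by lra.
have cvE : (fun d => (pc d)%:E) @ \oo --> 0%:E by apply/cvg_EFin => //; exact: nearW.
(* A sequence tending to 0 has limit inferior 0, against the required positivity. *)
move: tp; rewrite (_ : limn_einf _ = 0) ?ltxx//.
rewrite -[RHS](cvg_lim _ cvE)//; apply: is_cvg_limn_einfE.
by apply/cvg_ex; exists 0%:E.
Qed.
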